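(* Let $W^1$ be a standard Brownian motion over $\mathbb{R}_+$, let $a,b,c>0$ and $\alpha\in(0,\tfrac12)$, and let $W^\alpha:=D^\alpha(W^1)$. For $n\in\mathbb{N}$ let $X^n=\{X^n_t\}_{t\in\mathbb{R}_+}$ be the unique process with $X^n_0=0$ verifying over $\mathbb{R}_+$ the random ordinary differential equation $$(X^n_t)'=n\left(aW^\alpha_{X^n_t}+bt-X^n_t\right)+c,$$ and define the fractional inverse-Gaussian process $$X^0_t:=\inf\{x>0:x-aW^\alpha_x>bt\}.$$ Then, almost surely, $d_{\overline{\Phi}}(X^n,X^0)=\Vert E(X^0)-(X^n)^{-1}\Vert_{\mathbb{R}_+}\to0$ as $n\to\infty$.
   Context: $\mathbb{R}_+=[0,\infty)$. For a path $w$ with $w(0)=0$ that is locally Hölder continuous of order $\lambda\in(0,1)$ on $\mathbb{R}_+$ and $\alpha\in(0,\lambda)$, the Riemann-Liouville fractional derivative is $$D^\alpha(w)(x):=\frac{1}{\Gamma(1-\alpha)}\frac{\mathrm{d}}{\mathrm{d}x}\int_0^x\frac{w(u)}{(x-u)^\alpha}\,\mathrm{d}u,$$ a well-defined locally $(\lambda-\alpha)$-Hölder path starting from $0$; it is applied pathwise to $W^1$. $\overline{\Phi}$ is the set of strictly increasing càdlàg paths $\overline{\varphi}:\mathbb{R}_+\to\mathbb{R}_+$ with $\lim_{t\to\infty}\overline{\varphi}(t)=\infty$; the processes $X^n$ (whose paths are a.s. $C^1$ bijections of $\mathbb{R}_+$, with inverse $(X^n)^{-1}$) and $X^0$ are a.s.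 in $\overline{\Phi}$. Exit-time functional: $E(\overline{\varphi})(x):=\inf\{t>0:\overline{\varphi}(t)>x\}$. Exit-time metric: $d_{\overline{\Phi}}(\overline{\varphi}_1,\overline{\varphi}_2):=\Vert E(\overline{\varphi}_2)-E(\overline{\varphi}_1)\Vert_{\mathbb{R}_+}$ with $\Vert w\Vert_{\mathbb{R}_+}:=\sum_{n\in\mathbb{N}}2^{-n}(1\wedge\sup_{x\in[0,n]}|w(x)|)$. *)

(* Defs.v *)
From HB Require Import structures.
From mathcomp Require Import all_boot all_order all_algebra.
From mathcomp Require Import all_classical all_reals all_analysis.

Set Implicit Arguments.
Unset Strict Implicit.
Unset Printing Implicit Defensive.
Import Order.TTheory GRing.Theory Num.Theory.
Import numFieldNormedType.Exports.
Local Open Scope classical_set_scope.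
Local Open Scope ring_scope.

(* Paths over [0, +oo[ are represented by functions R -> R whose values at
   negative arguments are irrelevant, and processes by families of random
   variables indexed by R, of which only the nonnegative times matter. *)
Definition Rplus (R : realType) : set R := `[0, +oo[.

(* The law of the increments is only required for s < t, because the library
   sets normal_prob m 0 to a uniform law and not to the Dirac mass at m. *)
Record standard_brownian_motion d (T : measurableType d) (R : realType)
    (P : probability T R) (W : R -> {RV P >-> R}) : Prop := {
  brownian_start : {ae P, forall w, W 0 w = 0} ;
  brownian_indep : forall (n : nat) (t : nat -> R) (B : nat -> set R),
    0 <= t 0%N ->
    (forall i, t i <= t i.+1) ->
    (forall i, measurable (B i)) ->
    P [set w | forall i, (i < n)%N -> B i (W (t i.+1) w - W (t i) w)] =
    (\prod_(i < n) P [set w | B i (W (t i.+1) w - W (t i) w)%R])%E ;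
  brownian_gauss : forall (s t : R) (B : set R), 0 <= s -> s < t ->
    measurable B ->
    P [set w | B (W t w - W s w)] = normal_prob 0 (Num.sqrt (t - s)) B ;
  brownian_continuous :
    {ae P, forall w, {within @Rplus R, continuous (fun t => W t w)}}
}.

Section paths.
Context {R : realType}.
Implicit Types (f g w v phi x : R -> R) (alpha s t y : R).

Definition Gamma s : R :=
  \int[lebesgue_measure]_(u in `]0, +oo[) (u `^ (s - 1) * expR (- u)).

(* The integral vanishes for y <= 0, so that for w(0) = 0 and w Hoelder
   continuous of order > alpha the two-sided derivative at 0 exists and is 0. *)
Definition riemann_liouville alpha w : R -> R := fun y =>
  (Gamma (1 - alpha))^-1 *
  (fun z => \int[lebesgue_measure]_(u in `[0, z]) (w u / (z - u) `^ alpha))^`()%classic y.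

(* f has derivative l at t relative to [0, +oo[ (the right derivative at 0). *)
Definition is_derive_Rplus f t (l : R) : Prop :=
  (f s - f t) / (s - t) @[s --> within (@Rplus R) t^'] --> l.

Definition solves_rode (n : nat) (a b c : R) v x : Prop :=
  [/\ x 0 = 0,
      (forall t, 0 <= t -> 0 <= x t) &
      (forall t, 0 <= t ->
         is_derive_Rplus x t (n%:R * (a * v (x t) + b * t - x t) + c))].

Definition fractional_inverse_gaussian (a b : R) v : R -> R := fun t =>
  inf [set y | 0 < y /\ y - a * v y > b * t].

Definition Phibar : set (R -> R) := [set phi : R -> R |
  [/\ (forall t, 0 <= t -> 0 <= phi t),
      (forall s t, 0 <= s -> s < t -> phi s < phi t),
      (forall t, 0 <= t -> phi s @[s --> t^'+] --> phi t),
      (forall t, 0 < t -> cvg (phi s @[s --> t^'-])) &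
      phi t @[t --> +oo] --> +oo]].

Definition exit_time phi : R -> R := fun y => inf [set t | 0 < t /\ phi t > y].

(* Suprema are taken in \bar R, where the empty and unbounded cases of the real
   supremum cause no trouble; the value always lies in [0, 1]. The index set of
   the sum is {1, 2, ...}. *)
Definition norm_Rplus w : \bar R :=
  (\sum_(1 <= k <oo) ((2 ^- k)%R%:E *
     Order.min 1 (ereal_sup [set `|w y|%R%:E | y in `[0%R, k%:R]])))%E.

Definition dist_Phibar (phi1 phi2 : R -> R) : \bar R :=
  norm_Rplus (fun y => exit_time phi2 y - exit_time phi1 y).

(* The inverse of a bijection of [0, +oo[ onto itself. *)
Definition inverse_Rplus phi : R -> R :=
  'pinv_(fun=> 0) (@Rplus R) phi.

End paths.

(* Main.v *)
Require Import Defs.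
From HB Require Import structures.
From mathcomp Require Import all_boot all_order all_algebra.
From mathcomp Require Import ring lra.
From mathcomp Require Import all_classical all_reals all_analysis.
From mathcomp Require Import measurable_realfun.

(** Put f(x) = x - a W^alpha_x. At a fixed level the right-hand side of the
    equation increases with t, so a solution that came back to a level would have
    a larger derivative there; hence X^n is strictly increasing, whatever the path
    W^alpha is. The exit time of X^0 is E(X^0)(y) = max_[0,y] f / b. As X^n has
    nonnegative speed, b (X^n)^-1(y) >= max_[0,y] f - c / n; and as its speed
    below the level y is at least n b e once b t >= max_[0,y] f + b e, the level y
    is reached before the time E(X^0)(y) + e + y / (n b e). With e = n^(-1/2) the
    difference of the exit times is O((1 + y) n^(-1/2)), uniformly in y.

    This uses of W^alpha only that it is continuous, vanishes at 0, and that f is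
    unbounded above. Gaussian tails and subadditivity bound the dyadic increments:
    almost surely the increment of W^1 over [k 2^-n, (k+1) 2^-n] with
    (k+1) 2^-n <= J is at most C J^eta 2^(-lambda n), where eta < alpha < lambda.
    By chaining, W^1 is lambda-Hoelder, and the second differences of step h of
    its fractional integral F are O(h^(1 + lambda - alpha)), so that F is C^1. If
    f were bounded above, F would grow quadratically, whereas chaining also gives
    F(x) = O(x^(2 + eta - alpha)). *)

Set Implicit Arguments.
Unset Strict Implicit.
Unset Printing Implicit Defensive.
Import Order.TTheory GRing.Theory Num.Theory.
Import numFieldNormedType.Exports.
Local Open Scope classical_set_scope.
Local Open Scope ring_scope.

(** * Dyadic sequences and second differences *)

Lemma powR_exprn (R : realType) (x e : R) (n : nat) : 0 <= x ->
  (x ^+ n) `^ e = (x `^ e) ^+ n.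
Proof.
by move=> x0; rewrite -powR_mulrn // -powRrM mulrC powRrM powR_mulrn // powR_ge0.
Qed.

Lemma powR_half_lt1 (R : realType) (e : R) : 0 < e -> (2^-1 : R) `^ e < 1.
Proof.
move=> e0; apply: (@lt_le_trans _ _ (1 `^ e)); last by rewrite powR1.
apply: gt0_ltr_powR; rewrite ?nnegrE ?ler01 ?invr_ge0 //.
by rewrite invf_lt1 // ltr1n.
Qed.

(** With [e n] the tail of the geometric series, [u n - e n] is nondecreasing and [u n + e n]
    nonincreasing. The supremum of the lower sequence lies between the two, which gives the limit
    together with its rate. *)
Lemma geometric_increments_limit (R : realType) (u : nat -> R) (C r : R) :
  0 < r -> r < 1 -> (forall n, `|u n.+1 - u n| <= C * r ^+ n) ->
  exists l, forall n, `|u n - l| <= C * r ^+ n / (1 - r).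
Proof.
move=> r0 r1 hu.
have r1' : 0 < 1 - r by rewrite subr_gt0.
pose e n := C * r ^+ n / (1 - r).
have eS n : e n - e n.+1 = C * r ^+ n.
  by rewrite /e exprS; field; rewrite gt_eqF.
have C0 : 0 <= C by have := hu 0%N; rewrite expr0 mulr1; exact: le_trans.
have e0 n : 0 <= e n by rewrite /e divr_ge0 ?mulr_ge0 ?exprn_ge0 // ltW.
pose lo n := u n - e n; pose hi n := u n + e n.
have loS n : lo n <= lo n.+1.
  by have := hu n; rewrite -eS ler_norml /lo => /andP[]; lra.
have hiS n : hi n.+1 <= hi n.
  by have := hu n; rewrite -eS ler_norml /hi => /andP[]; lra.
have loD n k : lo n <= lo (n + k)%N.
  by elim: k => [|k IH]; rewrite ?addn0 // addnS (le_trans IH).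
have hiD n k : hi (n + k)%N <= hi n.
  by elim: k => [|k IH]; rewrite ?addn0 // addnS (le_trans _ IH).
have lohi n k : lo n <= hi k.
  apply: (le_trans (loD n k)); apply: (le_trans _ (hiD k n)).
  by rewrite addnC /lo /hi; have := e0 (k + n)%N; lra.
exists (sup (range lo)) => n.
rewrite -/(e n) ler_norml; apply/andP; split.
  suff : sup (range lo) <= hi n by rewrite /hi; lra.
  by apply: ge_sup; [exists (lo 0%N), 0%N|move=> _ [k _ <-]].
suff : lo n <= sup (range lo) by rewrite /lo; lra.
by apply: ub_le_sup; [exists (hi n) => _ [k _ <-]|exists n].
Qed.

Lemma half_pow_lt (R : realType) (e : R) : 0 < e -> exists n0, forall n, (n0 <=
  n)%N -> (2^-1 : R) ^+ n < e.
Proof.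
move=> e0; have : (2^-1 : R) ^+ n @[n --> \oo] --> 0.
  by apply: cvg_expr; rewrite ger0_norm; lra.
move/cvgrPdist_lt/(_ _ e0) => [n0 _ H]; exists n0 => n nn.
by have := H n nn; rewrite sub0r normrN ger0_norm ?exprn_ge0//; lra.
Qed.

Lemma pow_small (R : realType) (C r e : R) : 0 < r -> r < 1 -> 0 < e ->
  exists n0, forall n, (n0 <= n)%N -> C * r ^+ n < e.
Proof.
move=> r0 r1 e0; have : C * r ^+ n @[n --> \oo] --> C * 0.
  by apply: cvgMr; apply: cvg_expr; rewrite ger0_norm ?ltW.
rewrite mulr0.
move/cvgrPdist_lt/(_ _ e0) => [n0 _ H]; exists n0 => n nn.
by have := H n nn; rewrite sub0r normrN; apply: le_lt_trans; rewrite ler_norm.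
Qed.

Lemma dyadic_approx (R : realType) (x : R) (n : nat) : 0 <= x ->
  (Num.truncn (x * 2 ^+ n))%:R * 2^-1 ^+ n <= x <
  (Num.truncn (x * 2 ^+ n))%:R * 2^-1 ^+ n + 2^-1 ^+ n.
Proof.
move=> x0.
have p0 : 0 < (2 : R) ^+ n by rewrite exprn_gt0.
have /truncn_itv/andP[a b] : 0 <= x * 2 ^+ n by rewrite mulr_ge0 // ltW.
apply/andP; split; first by rewrite exprVn ler_pdivrMr.
by rewrite -[X in _ < _ + X]mul1r -mulrDl exprVn ltr_pdivlMr // natr1.
Qed.

(** Steps of length [2^-n] lead from [a] to a point within [2^-n] of [b], and the bounds on the
    steps add up. The remaining gap disappears by continuity at [b] as [n] grows. *)
Lemma dyadic_lipschitz (R : realType) (G : R -> R) (a b M : R) (n0 : nat) :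
  0 <= M -> a <= b -> {for b, continuous G} ->
  (forall n y, (n0 <= n)%N -> a <= y -> y + 2^-1 ^+ n <= b ->
    `|G (y + 2^-1 ^+ n) - G y| <= M * 2^-1 ^+ n) ->
  `|G b - G a| <= M * (b - a).
Proof.
move=> M0 ab cG hG.
have step n j : (n0 <= n)%N -> a + j%:R * 2^-1 ^+ n <= b ->
   `|G (a + j%:R * 2^-1 ^+ n) - G a| <= M * (j%:R * 2^-1 ^+ n).
  move=> nn; have q0 : 0 < (2^-1 : R) ^+ n by rewrite exprn_gt0 // invr_gt0.
  elim: j => [|j IH]; first by rewrite !mul0r mulr0 addr0 subrr normr0.
  rewrite -natr1 mulrDl mul1r addrA => h.
  have {}IH := IH (ltac:(lra)).
  have := hG n (a + j%:R * 2^-1 ^+ n) nn.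
  have jq : 0 <= j%:R * (2^-1 : R) ^+ n by rewrite mulr_ge0 // ltW.
  move=> /(_ ltac:(lra) h) h2.
  apply: (le_trans (ler_distD (G (a + j%:R * 2^-1 ^+ n)) _ _)).
  by rewrite mulrDr [leRHS]addrC lerD.
apply/ler_addgt0Pr => e e0.
have /cvgrPdist_lt/(_ _ e0)[d /= d0 hd] : G x @[x --> b] --> G b := cG.
have [n1 hn1] := half_pow_lt d0.
pose n := maxn n0 n1.
have /andP[h1 h2] := @dyadic_approx R (b - a) n (ltac:(lra)).
set c := _ * _ in h1 h2.
have hn : (2^-1 : R) ^+ n < d by apply: hn1; rewrite leq_maxr.
have s := step n (Num.truncn ((b - a) * 2 ^+ n)) (leq_maxl _ _) (ltac:(rewrite
  -/c; lra)).
rewrite -/c in s.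
have := hd (a + c); rewrite /= => /(_ _) hh.
have {}hh : `|G b - G (a + c)| < e.
  by apply: hh; rewrite ger0_norm; lra.
apply: (le_trans (ler_distD (G (a + c)) _ _)).
rewrite addrC lerD //; last exact: ltW.
by apply: (le_trans s); rewrite ler_wpM2l.
Qed.

Section second_differences.
Context {R : realType} (F : R -> R) (r : R).
Hypotheses (r0 : 0 < r) (r1 : r < 1) (cF : continuous F).
Hypothesis second_difference : forall N : R, exists C : R, forall (z : R) n, z <=
  N ->
  `|F (z + 2 * 2^-1 ^+ n) - 2 * F (z + 2^-1 ^+ n) + F z| <= C * 2^-1 ^+ n * r ^+ n.

Let D n z := (F (z + 2^-1 ^+ n) - F z) * 2 ^+ n.

Let pq n : (2^-1 : R) ^+ n * 2 ^+ n = 1.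
Proof. by rewrite -exprMn mulVf // expr1n. Qed.

Let D_increments (N : R) : exists C : R, forall (z : R) n, z <= N ->
  `|D n.+1 z - D n z| <= C * r ^+ n.
Proof.
have [C hC] := second_difference N.
have C0 : 0 <= C.
  have := hC N 0%N (lexx _); rewrite !expr0 !mulr1; exact: le_trans.
exists C => z n zN.
have := hC z n.+1 zN.
have -> : z + 2 * 2^-1 ^+ n.+1 = z + 2^-1 ^+ n by rewrite [2^-1 ^+ n.+1]exprS;
  field.
move=> h.
have -> : D n.+1 z - D n z =
  - (F (z + 2^-1 ^+ n) - 2 * F (z + 2^-1 ^+ n.+1) + F z) * 2 ^+ n.
  by rewrite /D [2 ^+ n.+1]exprS; ring.
have p0 : 0 < (2 : R) ^+ n by rewrite exprn_gt0.
rewrite normrM normrN (ger0_norm (ltW p0)).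
apply: (@le_trans _ _ (C * 2^-1 ^+ n.+1 * r ^+ n.+1 * 2 ^+ n)).
  by rewrite ler_pM2r.
have -> : C * 2^-1 ^+ n.+1 * r ^+ n.+1 * 2 ^+ n = C * r ^+ n * (r / 2) * ((2^-1)
  ^+ n * 2 ^+ n).
  by rewrite !exprS; ring.
rewrite pq mulr1 ler_piMr //; last by rewrite ler_pdivrMr // mul1r (le_trans (ltW
  r1)) // ler1n.
by rewrite mulr_ge0 // exprn_ge0 // ltW.
Qed.

(** The difference quotients [D n] at step [2^-n] change from [n] to [n.+1] by a second difference
    times [2^n], so they converge geometrically, uniformly on each half-line [z <= N]. The limit is
    therefore continuous, and [dyadic_lipschitz] shows that it is the derivative. *)
Lemma C1_of_second_differences : exists g : R -> R, continuous g /\ forall z : R,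
  is_derive z 1 F (g z).
Proof.
have /choice[C hC] := D_increments.
have r1' : 0 < 1 - r by rewrite subr_gt0.
have : forall z, exists l, forall N, z <= N -> forall n, `|D n z - l| <= C N * r
  ^+ n / (1 - r).
  move=> z.
  have [l hl] := geometric_increments_limit r0 r1 (fun n => hC z z n (lexx z)).
  exists l => N zN n.
  (* The limit was found with the constant of the half-line ending at [z]. The constant of a longer
     half-line yields a limit of the same sequence, hence the same one, so that the rate becomes
     uniform in [z]. *)
  have [l' hl'] := geometric_increments_limit r0 r1 (fun n => hC N z n zN).
  suff -> : l = l' by [].
  apply/eqP; rewrite -subr_eq0 -normr_eq0 eq_le normr_ge0 andbT.
  apply/ler_addgt0Pr => e e0; rewrite add0r.
  have e20 : 0 < e / 2 by rewrite divr_gt0.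
  have [n1 h1] := pow_small (C z / (1 - r)) r0 r1 e20.
  have [n2 h2] := pow_small (C N / (1 - r)) r0 r1 e20.
  pose m := maxn n1 n2.
  have a1 := h1 m (leq_maxl _ _); have a2 := h2 m (leq_maxr _ _).
  have b1 := hl m; have b2 := hl' m.
  rewrite -mulrA [r ^+ m / _]mulrC mulrA in b1.
  rewrite -mulrA [r ^+ m / _]mulrC mulrA in b2.
  rewrite distrC in b1.
  by apply: (le_trans (ler_distD (D m z) _ _)); lra.
move=> /choice[g hg]; exists g.
have hg' N n z : z <= N -> `|D n z - g z| <= C N / (1 - r) * r ^+ n.
  by move=> zN; rewrite mulrAC; exact: hg.
have cD n : continuous (D n).
  move=> z; apply: cvgMl; apply: cvgB; last exact: cF.
  apply: continuous_cvg; first exact: cF.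
  by apply: cvgD; [exact: cvg_id|exact: cvg_cst].
have cg : continuous g.
  move=> z0; apply/cvgrPdist_lt => e e0.
  have e30 : 0 < e / 3 by rewrite divr_gt0.
  have [n hn] := pow_small (C (z0 + 1) / (1 - r)) r0 r1 e30.
  have {}hn := hn n (leqnn _).
  have /cvgrPdist_lt/(_ _ e30) : D n x @[x --> z0] --> D n z0 := cD n z0.
  have z1 : \forall z \near z0, z < z0 + 1.
    by apply: lt_nbhsl; rewrite ltrDl.
  move=> nD; near=> z.
  have zz1 : z < z0 + 1 by near: z.
  have a1 := hg' (z0 + 1) n z (ltW zz1).
  have a2 := hg' (z0 + 1) n z0 (ltac:(lra)).
  have a3 : `|D n z0 - D n z| < e / 3 by near: z.
  rewrite distrC in a2.
  apply: (le_lt_trans (ler_distD (D n z0) _ _)).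
  rewrite (_ : e = e / 3 + (e / 3 + e / 3)); last by field.
  apply: ler_ltD; first lra.
  apply: (le_lt_trans (ler_distD (D n z) _ _)); apply: ltr_leD => //; lra.
split=> // z0.
(* Subtracting the tangent [t * g z0] leaves a function whose small dyadic quotients near [z0] are
   at most [e]. The form with two points [x <= y] serves both signs of the increment [h]. *)
have key e : 0 < e -> exists2 d, 0 < d & forall x y, x <= y -> `|x - z0| < d ->
  `|y - z0| < d ->
   `|F y - F x - (y - x) * g z0| <= e * (y - x).
  move=> e0.
  have e20 : 0 < e / 2 by rewrite divr_gt0.
  have /cvgrPdist_lt/(_ _ e20)[d0 /= d00 hd0] : g x @[x --> z0] --> g z0 := cg z0.
  have [n0 hn0] := pow_small (C (z0 + 1) / (1 - r)) r0 r1 e20.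
  exists (Num.min d0 1); first by rewrite lt_min d00 ltr01.
  move=> x y xy; rewrite !lt_min => /andP[x0 x1] /andP[y0 y1].
  pose G t := F t - t * g z0.
  have -> : F y - F x - (y - x) * g z0 = G y - G x by rewrite /G; ring.
  apply: (@dyadic_lipschitz R G x y e n0) => //; first exact: ltW.
    apply: cvgB; first exact: cF.
    by apply: cvgMl; exact: cvg_id.
  move=> n t nn xt ty.
  have q0 : 0 < (2^-1 : R) ^+ n by rewrite exprn_gt0 // invr_gt0.
  move: x0 x1 y0 y1; rewrite !ltr_norml => /andP[? ?] /andP[? ?] /andP[? ?]
    /andP[? ?].
  have a1 := hg' (z0 + 1) n t (ltac:(lra)).
  have a2 := hn0 n nn.
  have a3 : `|g z0 - g t| < e / 2 by apply: hd0; rewrite /= ltr_norml; lra.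
  have -> : G (t + 2^-1 ^+ n) - G t = (D n t - g t - (g z0 - g t)) * 2^-1 ^+ n.
    rewrite /G /D [X in _ = X](_ : _ = (F (t + 2^-1 ^+ n) - F t) * (2^-1 ^+ n * 2
      ^+ n) - g z0 * 2^-1 ^+ n); last by ring.
    by rewrite pq; ring.
  rewrite normrM (ger0_norm (ltW q0)) ler_pM2r //.
  by apply: (le_trans (ler_normB _ _)); lra.
have cv : h^-1 *: (F (h *: 1 + z0) - F z0) @[h --> 0^'] --> g z0.
  apply/cvgrPdist_le => e e0.
  have [d d0 hd] := key _ e0.
  near=> h.
  have hn0 : h != 0 by near: h; exact: nbhs_dnbhs_neq.
  have hd' : `|h| < d.
    by near: h; apply: dnbhs0_lt.
  rewrite /GRing.scale /= mulr1.
  have -> : g z0 - h^-1 * (F (h + z0) - F z0) = - h^-1 * (F (h + z0) - F z0 - h *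
    g z0).
    by field.
  rewrite normrM normrN normfV mulrC ler_pdivrMr ?normr_gt0 //.
  have [hp|hp] := ltP 0 h.
    have H := hd z0 (h + z0); rewrite subrr normr0 addrK in H.
    rewrite (gtr0_norm hp) in hd' H *.
    by apply: H => //; lra.
  have H := hd (h + z0) z0; rewrite subrr normr0 addrK in H.
  rewrite (ler0_norm hp) in hd' H *.
  have -> : F (h + z0) - F z0 - h * g z0 = - (F z0 - F (h + z0) - (z0 - (h + z0))
    * g z0) by ring.
  have -> : - h = z0 - (h + z0) by ring.
  by rewrite normrN; apply: H => //; lra.
apply: DeriveDef; first by apply/cvg_ex; exists (g z0).
by apply: cvg_lim.
Unshelve. all: by end_near.
Qed.

End second_differences.

(** * Calculus on the half-line *)

Section half_line_calculus.
Context {R : realType}.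
Implicit Types (f x : R -> R) (s t l e M : R).

(* Functions on the half-line are made total by extending them constantly to the
   left, so that the theorems on real functions apply. *)
Definition clamp f : R -> R := fun s => f (Num.max s 0).

Lemma clampE f s : 0 <= s -> clamp f s = f s.
Proof. by move=> s0; rewrite /clamp max_l. Qed.

Lemma continuous_clamp f :
  (forall t, 0 <= t -> forall e, 0 < e -> exists2 d, 0 < d &
    forall s, 0 <= s -> `|t - s| < d -> `|f t - f s| < e) ->
  continuous (clamp f).
Proof.
move=> H t; apply/cvgrPdist_lt => e e0.
have m0 (u : R) : 0 <= Num.max u 0 by rewrite le_max lexx orbT.
have [d d0 hd] := H _ (m0 t) _ e0.
exists d => // s /= ts; apply: hd => //.
apply: le_lt_trans ts.
case: (leP t 0) => ?; case: (leP s 0) => ?; rewrite ?subrr ?normr0 //.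
  by rewrite sub0r normrN distrC !ger0_norm; lra.
by rewrite subr0 !ger0_norm; lra.
Qed.

Lemma within_Rplus_continuous_clamp f :
  {within @Rplus R, continuous f} -> continuous (clamp f).
Proof.
move=> /subspace_continuousP H; apply: continuous_clamp => t t0 e e0.
have /H/cvgrPdist_lt/(_ _ e0)[d /= d0 hd] : Rplus t by rewrite /Rplus /= in_itv
  /= t0.
by exists d => // s s0 ts; apply: hd => //; rewrite /Rplus /= in_itv /= s0.
Qed.

Lemma is_derive_RplusP f t l : is_derive_Rplus f t l ->
  forall e, 0 < e -> exists2 d, 0 < d & forall s, 0 <= s -> s != t -> `|t - s| <
    d ->
    `|l - (f s - f t) / (s - t)| < e.
Proof.
move=> /cvgrPdist_lt H e /H [d /= d0 hd].
by exists d => // s s0 st ts; apply: hd => //; rewrite /Rplus /= in_itv /= s0.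
Qed.

Lemma is_derive_Rplus_continuous f t l : is_derive_Rplus f t l ->
  forall e, 0 < e -> exists2 d, 0 < d &
    forall s, 0 <= s -> `|t - s| < d -> `|f t - f s| < e.
Proof.
move=> /is_derive_RplusP /(_ 1 ltr01)[d d0 hd] e e0.
have l0 : 0 < `|l| + 1 by rewrite ltr_wpDl.
exists (Num.min d (e / (`|l| + 1))); first by rewrite lt_min d0 divr_gt0.
move=> s s0; rewrite lt_min => /andP[sd se].
have [->|st] := eqVneq s t; first by rewrite subrr normr0.
have st' : s - t != 0 by rewrite subr_eq0.
have := hd s s0 st sd; set q := _ / _ => hq.
have -> : f t - f s = q * (t - s) by rewrite /q; field.
rewrite normrM.
have : `|q| <= `|l| + 1.
  have -> : q = l - (l - q) by ring.
  by apply: (le_trans (ler_normB _ _)); rewrite lerD2l ltW.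
move=> ql; apply: (@le_lt_trans _ _ ((`|l| + 1) * `|t - s|)); first by rewrite
  ler_wpM2r.
by rewrite mulrC -ltr_pdivlMr.
Qed.

Lemma is_derive_Rplus_interior f t l : 0 < t -> is_derive_Rplus f t l ->
  is_derive t 1 (clamp f) l.
Proof.
move=> t0 /is_derive_RplusP H.
have cv : h^-1 *: (clamp f (h *: 1 + t) - clamp f t) @[h --> 0^'] --> l.
  apply/cvgrPdist_lt => e /H [d d0 hd].
  near=> h.
  have hn0 : h != 0 by near: h; exact: nbhs_dnbhs_neq.
  have h1 : `|h| < d by near: h; apply: dnbhs0_lt.
  have h2 : `|h| < t by near: h; apply: dnbhs0_lt.
  rewrite /GRing.scale /= mulr1.
  have ht : 0 <= h + t by move: h2; rewrite ltr_norml => /andP[]; lra.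
  rewrite !clampE ?(ltW t0) // mulrC.
  have -> : h^-1 = (h + t - t)^-1 by rewrite addrK.
  apply: hd => //; first by rewrite -subr_eq0 addrK.
  by have -> : t - (h + t) = - h; [ring|rewrite normrN].
apply: DeriveDef; first by apply/cvg_ex; exists l.
by apply: cvg_lim.
Unshelve. all: by end_near.
Qed.

(** This reads off the sign of a derivative at a positive time from the values of [f] on [[p, t)]
    alone. *)
Lemma is_derive_Rplus_left f t l p : 0 <= p -> p < t -> is_derive_Rplus f t l ->
  forall e, 0 < e -> exists2 s, p <= s < t & `|l - (f s - f t) / (s - t)| < e.
Proof.
move=> p0 pt /is_derive_RplusP H e /H [d d0 hd].
pose s := Num.max p (t - d / 2).
have [s1 s2 s3] : [/\ p <= s, s < t & t - s < d].
  by rewrite /s; case: (leP p (t - d / 2)) => ?; split; lra.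
exists s; first by rewrite s1.
apply: hd; [lra|by rewrite lt_eqF|by rewrite gtr0_norm; lra].
Qed.

(** The hitting time is the supremum of the times up to which [g] stays below [y]. By continuity,
    [g] can be neither below nor above [y] there. *)
Lemma first_hitting_time (g : R -> R) p q y : continuous g -> p < q ->
  g p < y -> y <= g q ->
  exists s, [/\ p < s, s <= q, g s = y & forall r, p <= r -> r < s -> g r < y].
Proof.
move=> cg pq gp gq.
pose A := [set s | p <= s /\ forall r, p <= r -> r <= s -> g r < y].
have Aub s : A s -> s <= q.
  by move=> [ps hs]; rewrite leNgt; apply/negP => qs; have := hs q (ltW pq) (ltW
    qs); rewrite ltNge gq.
have Ap : A p.
  by split=> // r pr rp; have -> : r = p by apply/eqP; rewrite eq_le pr rp.
have hub : has_ubound A by exists q => s /Aub.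
have ps : p <= sup A by exact: ub_le_sup.
have below r : p <= r -> r < sup A -> g r < y.
  move=> pr /sup_gt[|s [_ hs] rs]; first by exists p.
  by apply: hs => //; exact: ltW.
have sq : sup A <= q by apply: ge_sup; [exists p|move=> s /Aub].
have gs1 : y <= g (sup A).
  rewrite leNgt; apply/negP => gs.
  have /cvgrPdist_lt/(_ (y - g (sup A))) : g x @[x --> sup A] --> g (sup A) := cg _.
  rewrite subr_gt0 => /(_ gs)[d /= d0 hd].
  have : A (sup A + d / 2).
    split=> [|r pr rs]; first lra.
    have [rs'|rs'] := ltP r (sup A); first exact: below.
    have := hd r; rewrite /= distrC ger0_norm; last lra.
    move=> /(_ ltac:(lra)); rewrite distrC => h; have := ler_norm (g r - g (sup
      A)); lra.
  by move=> /(ub_le_sup hub); lra.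
have ps' : p < sup A.
  rewrite lt_neqAle ps andbT; apply/eqP => e.
  by move: gs1; rewrite -e leNgt gp.
exists (sup A); split=> //.
apply/eqP; rewrite eq_le gs1 andbT leNgt; apply/negP => gs.
have /cvgrPdist_lt/(_ (g (sup A) - y)) : g x @[x --> sup A] --> g (sup A) := cg _.
rewrite subr_gt0 => /(_ gs)[d /= d0 hd].
pose s := Num.max p (sup A - d / 2).
have [s1 s2 s3] : [/\ p <= s, s < sup A & sup A - s < d].
  by rewrite /s; case: (leP p (sup A - d / 2)) => ?; split; lra.
have := below s s1 s2.
have := hd s; rewrite /= gtr0_norm; last lra.
move=> /(_ s3) h; have := ler_norm (g (sup A) - g s); lra.
Qed.

Lemma clamp_mean_value_ge f (df : R -> R) p q k : 0 <= p -> p <= q ->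
  (forall t, 0 <= t -> is_derive_Rplus f t (df t)) ->
  (forall t, p < t -> t < q -> k <= df t) -> k * (q - p) <= f q - f p.
Proof.
move=> p0; rewrite le_eqVlt => /predU1P[<- _ _|pq hf hk]; first by rewrite !subrr
  mulr0.
have cf : continuous (clamp f).
  by apply: continuous_clamp => t t0; exact: is_derive_Rplus_continuous (hf t t0).
have [] := @MVT R (clamp f) df p q pq.
- move=> t; rewrite in_itv /= => /andP[pt tq].
  by apply: is_derive_Rplus_interior; [lra|apply: hf; lra].
- exact: continuous_subspaceT.
move=> t; rewrite in_itv /= => /andP[pt tq].
rewrite !clampE //; last lra.
by move=> ->; rewrite ler_pM2r ?subr_gt0 // hk.
Qed.

End half_line_calculus.

(** * Bounds on the weighted supremum norm *)

Section exit_times.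
Context {R : realType}.
Implicit Types (phi w : R -> R).

Lemma eq_norm_Rplus w1 w2 : (forall y, 0 <= y -> w1 y = w2 y) ->
  norm_Rplus w1 = norm_Rplus w2.
Proof.
move=> H; rewrite /norm_Rplus; apply: eq_eseriesr => k _.
congr (_ * Order.min 1 (ereal_sup _))%E.
by apply/seteqP; split=> _ [y /= yk <-]; exists y => //; move: yk; rewrite in_itv
  /= => /andP[y0 _]; rewrite H.
Qed.

Lemma norm_Rplus_term_ge0 w (k : nat) :
  (0 <= (2 ^- k)%R%:E * Order.min 1 (ereal_sup [set `|w y|%R%:E | y in `[0%R,
    k%:R]]))%E.
Proof.
apply: mule_ge0; first by rewrite lee_fin invr_ge0 exprn_ge0.
rewrite le_min lee01 /=; apply: (@le_trans _ _ `|w 0|%:E); first by rewrite lee_fin.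
by apply: ereal_sup_ubound; exists 0 => //; rewrite /= in_itv /= lexx ler0n.
Qed.

Lemma norm_Rplus_ge0 w : (0 <= norm_Rplus w)%E.
Proof. by apply: nneseries_ge0 => k _ _; exact: norm_Rplus_term_ge0. Qed.

Lemma norm_Rplus_le_linear w (B : R) : 0 <= B ->
  (forall y, 0 <= y -> `|w y| <= B * (1 + y)) -> (norm_Rplus w <= (3 * B)%:E)%E.
Proof.
move=> B0 hw.
(* The factor 3 is the sum of [2^-k * (1 + k)] over [k >= 1]. The closed form of the partial sums
   displays the negative remainder. *)
have key n : (0 < n)%N ->
    \sum_(1 <= k < n) 2 ^- k * (B * (1 + k%:R)) = B * (3 - (n%:R + 2) * 2 * 2^-1
      ^+ n).
  elim: n => // -[|n] IH _; first by rewrite big_geq // expr1; field.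
  by rewrite big_nat_recr //= IH // -exprVn [2^-1 ^+ n.+2]exprS -[n.+2%:R]natr1;
    field.
apply: lime_le.
  by apply: is_cvg_nneseries => k _ _; exact: norm_Rplus_term_ge0.
near=> n.
apply: (@le_trans _ _ (\sum_(1 <= k < n) (2 ^- k * (B * (1 + k%:R)))%:E)%E).
  apply: lee_sum => k _; rewrite EFinM.
  apply: lee_wpmul2l; first by rewrite lee_fin invr_ge0 exprn_ge0.
  rewrite ge_min; apply/orP; right.
  apply: ge_ereal_sup => _ [y /= hy <-]; move: hy; rewrite in_itv /= => /andP[y0
    yk].
  by rewrite lee_fin (le_trans (hw y y0)) // ler_wpM2l // lerD2l.
rewrite sumEFin lee_fin.
rewrite key; last by near: n; exact: nbhs_infty_gt.
rewrite mulrC ler_wpM2r //.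
by rewrite gerBl !mulr_ge0 ?addr_ge0 ?exprn_ge0 // invr_ge0.
Unshelve. all: by end_near.
Qed.

End exit_times.

(** * The random differential equation *)

Section random_ode.
Context {R : realType}.
Variables (n : nat) (a b c : R) (v x : R -> R).
Hypotheses (n_gt0 : (0 < n)%N) (b_gt0 : 0 < b) (c_gt0 : 0 < c).
Hypothesis x_sol : solves_rode n a b c v x.

Let G t := n%:R * (a * v (x t) + b * t - x t) + c.

Let x0 : x 0 = 0. Proof. by case: x_sol. Qed.
Let x_ge0 t : 0 <= t -> 0 <= x t. Proof. by case: x_sol => _ H _; exact: H. Qed.
Let dx t : 0 <= t -> is_derive_Rplus x t (G t). Proof. by case: x_sol => _ _ H;
  exact: H. Qed.
Let nR : 0 < n%:R :> R. Proof. by rewrite ltr0n. Qed.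

Lemma rode_clamp_continuous : continuous (clamp x).
Proof. by apply: continuous_clamp => t t0; exact: is_derive_Rplus_continuous (dx
  t0). Qed.

Let G_revisit s t : x s = x t -> G t = G s + n%:R * b * (t - s).
Proof. by rewrite /G => ->; ring. Qed.

Let nbt s t : s < t -> 0 < n%:R * b * (t - s).
Proof. by move=> st; rewrite !mulr_gt0 // subr_gt0. Qed.

(** If [x] decreased from [p] to [q], a level halfway would first be reached from below at some
    [s < p], and from above at some [t > p]. The derivative is nonnegative at [s] and nonpositive at
    [t], whereas [G_revisit] makes it larger at [t] by [n b (t - s)]. *)
Let rode_nondecreasing p q : 0 <= p -> p < q -> x p <= x q.
Proof.
move=> p0 pq; rewrite leNgt; apply/negP => xpq.
have q0 : 0 < q by lra.
have xq0 := x_ge0 (ltW q0).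
pose y := (x p + x q) / 2.
have [y1 y2] : x q < y /\ y < x p by rewrite /y; lra.
have p_gt0 : 0 < p.
  by rewrite lt_neqAle p0 andbT; apply/eqP => e; move: y2; rewrite -e x0; lra.
have cx := rode_clamp_continuous.
have := @first_hitting_time R (clamp x) 0 p y cx p_gt0.
rewrite !clampE // x0 => /(_ ltac:(lra) ltac:(lra)) [s [s0 sp xs hs]].
have cNx : continuous (fun t => - clamp x t) by move=> t; apply: cvgN; exact: cx.
have := @first_hitting_time R (fun t => - clamp x t) p q (- y) cNx pq.
rewrite !clampE ?(ltW q0) // => /(_ ltac:(lra) ltac:(lra)) [t [pt tq xt ht]].
rewrite clampE ?(ltW s0) // in xs; rewrite clampE in xt; last lra.
have st : s < t by lra.
have xst : x s = x t by lra.
have := G_revisit xst; have := nbt st.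
set e := _ * _ => e0 Gt.
have e20 : 0 < e / 2 by rewrite divr_gt0.
have [r1 /andP[r1a r1b] h1] := is_derive_Rplus_left (lexx 0) s0 (dx (ltW s0)) e20.
have [r2 /andP[r2a r2b] h2] := is_derive_Rplus_left p0 pt (dx (ltW (le_lt_trans
  p0 pt))) e20.
have q1 : 0 <= (x r1 - x s) / (r1 - s).
  apply: mulr_le0; last by rewrite invr_le0; lra.
  by have := hs r1 r1a r1b; rewrite clampE // xs; lra.
have q2 : (x r2 - x t) / (r2 - t) <= 0.
  apply: mulr_ge0_le0; last by rewrite invr_le0; lra.
  have := ht r2 r2a r2b; rewrite clampE; lra.
move: h1 h2; rewrite !ltr_norml => /andP[h1 h1'] /andP[h2 h2']; lra.
Qed.

(** If [x p = x q], then [x] is constant on [[p, q]], so its derivative vanishes at the midpoint and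
    at [q]. This contradicts [G_revisit]. *)
Lemma rode_increasing p q : 0 <= p -> p < q -> x p < x q.
Proof.
move=> p0 pq; rewrite lt_neqAle rode_nondecreasing // andbT; apply/eqP => xpq.
have cst r : p <= r -> r <= q -> x r = x p.
  rewrite le_eqVlt => /predU1P[->//|pr]; rewrite le_eqVlt => /predU1P[->//|rq].
  have := rode_nondecreasing p0 pr; have := @rode_nondecreasing r q; lra.
pose m := (p + q) / 2.
have [pm mq] : p < m /\ m < q by rewrite /m; lra.
have q_gt0 : 0 <= q by lra.
have m_gt0 : 0 <= m by lra.
have xmq : x m = x q by rewrite !cst; lra.
have := G_revisit xmq; have := nbt mq.
set e := _ * _ => e0 Gt.
have e20 : 0 < e / 2 by rewrite divr_gt0.
have [r1 /andP[r1a r1b] h1] := is_derive_Rplus_left p0 pm (dx m_gt0) e20.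
have [r2 /andP[r2a r2b] h2] := is_derive_Rplus_left p0 pq (dx q_gt0) e20.
move: h1 h2.
have -> : x r1 = x m by rewrite !cst; lra.
have -> : x r2 = x q by rewrite !cst; lra.
rewrite !subrr !mul0r !subr0 !ltr_norml => /andP[h1 h1'] /andP[h2 h2']; lra.
Qed.

Lemma rode_le p q : 0 <= p -> p <= q -> x p <= x q.
Proof. by move=> p0; rewrite le_eqVlt => /predU1P[->//|/(rode_increasing
  p0)/ltW]. Qed.

Lemma rode_lt_inv p q : 0 <= q -> x p < x q -> p < q.
Proof. by move=> q0; rewrite !ltNge; apply: contra; exact: rode_le. Qed.

Lemma rode_drift_ge0 t : 0 < t -> 0 <= n%:R * (a * v (x t) + b * t - x t) + c.
Proof.
move=> t0; rewrite -/(G t) leNgt; apply/negP => G0.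
have [r /andP[r1 r2]] := is_derive_Rplus_left (lexx 0) t0 (dx (ltW t0))
  (ltac:(lra) : 0 < - G t).
have : 0 <= (x r - x t) / (r - t).
  apply: mulr_le0; last by rewrite invr_le0; lra.
  by rewrite subr_le0; apply: rode_le; lra.
by move=> h; rewrite ltr_norml => /andP[]; lra.
Qed.

Hypothesis v_bounded : forall M : R, exists C : R, forall y, 0 <= y <= M -> `|v
  y| <= C.

(** A solution bounded by [M] only meets values of [v] bounded by some [C], while the term [b * t]
    keeps growing and finally forces a speed of at least 1. *)
Lemma rode_unbounded (M : R) : exists2 t, 0 <= t & M < x t.
Proof.
apply: contrapT => H.
have xM t : 0 <= t -> x t <= M.
  by move=> t0; rewrite leNgt; apply/negP => h; apply: H; exists t.
have M0 : 0 <= M by rewrite -x0; exact: xM.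
have [C hC] := v_bounded M.
have C0 : 0 <= C by apply: le_trans (hC 0 _); rewrite ?lexx.
(* From [t0] on, [b * t] exceeds the largest possible value of [x t - a * v (x t)] by 1. A further
   time [M + 1] then carries [x] beyond [M]. *)
pose t0 := (1 + `|a| * C + M) / b.
have t00 : 0 <= t0 by rewrite /t0 divr_ge0 ?addr_ge0 ?mulr_ge0 // ltW.
have bt0 : b * t0 = 1 + `|a| * C + M by rewrite /t0; field; rewrite gt_eqF.
have := @clamp_mean_value_ge R x G t0 (t0 + M + 1) 1 t00 ltac:(lra) dx.
have h1 : forall t, t0 < t -> t < t0 + M + 1 -> 1 <= G t.
  move=> t tt _; rewrite /G.
  have t_ge0 : 0 <= t by lra.
  have h : 1 <= a * v (x t) + b * t - x t.
    have bt : b * t0 <= b * t by rewrite ler_pM2l // ltW.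
    have : `|a * v (x t)| <= `|a| * C.
      by rewrite normrM ler_wpM2l // hC // x_ge0 //= xM.
    by rewrite ler_norml => /andP[]; have := xM t t_ge0; lra.
  have : 1 <= n%:R * (a * v (x t) + b * t - x t).
    by rewrite mulr_ege1 // ler1n.
  by move/le_trans; apply; rewrite lerDl ltW.
move=> /(_ h1).
by have := xM (t0 + M + 1) ltac:(lra); have := x_ge0 t00; lra.
Qed.

Lemma rode_surjective y : 0 <= y -> exists2 t, 0 <= t & x t = y.
Proof.
move=> y0; have [q q0 xq] := rode_unbounded y.
have [|||t] := @IVT R (clamp x) 0 q y => //.
- exact: continuous_subspaceT rode_clamp_continuous.
- by rewrite !clampE // x0 ge_min le_max y0 (ltW xq) orbT.
by rewrite in_itv /= => /andP[t0 _]; rewrite clampE // => <-; exists t.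
Qed.

Lemma rode_bij : set_bij (@Rplus R) (@Rplus R) x.
Proof.
split.
- by move=> t; rewrite /Rplus /= !in_itv /= !andbT => /x_ge0.
- move=> s t; rewrite !inE /Rplus /= !in_itv /= !andbT => s0 t0 e.
  apply/eqP; rewrite eq_le !leNgt; apply/andP; split; apply/negP.
    by move=> /(rode_increasing t0); rewrite e ltxx.
  by move=> /(rode_increasing s0); rewrite e ltxx.
- move=> y; rewrite /Rplus /= in_itv /= andbT => /rode_surjective[t t0 <-].
  by exists t => //; rewrite /= in_itv /= t0.
Qed.

Lemma rode_inverseE t : 0 <= t -> inverse_Rplus x (x t) = t.
Proof.
move=> t0; rewrite /inverse_Rplus pinvKV //; last by rewrite inE /Rplus /= in_itv
  /= t0.
by have [_ inj _] := rode_bij.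
Qed.

Lemma rode_exit_time t : 0 <= t -> exit_time x (x t) = t.
Proof.
move=> t0; rewrite /exit_time.
have -> : [set s | 0 < s /\ x t < x s] = `]t, +oo[%classic.
  apply/seteqP; split=> s /=; rewrite in_itv /= andbT.
    by move=> [s0 /rode_lt_inv]; apply; exact: ltW.
  by move=> ts; split; [lra|exact: rode_increasing].
by rewrite inf_itv // bnd_simp.
Qed.

Lemma rode_Phibar : Phibar x.
Proof.
split=> //.
- by move=> s t; exact: rode_increasing.
- move=> t t0; apply/cvgrPdist_lt => e /(is_derive_Rplus_continuous (dx t0))[d d0
    hd].
  exists d => // s /= ts st; apply: hd => //; exact: ltW (le_lt_trans t0 st).
- move=> t t0; apply: nondecreasing_at_left_is_cvgr.
    near=> s; move=> r r'; rewrite !in_itv /= => /andP[sr _] _ rr'.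
    apply: rode_le => //; apply: ltW; apply: le_lt_trans sr.
    by near: s; apply: nbhs_left_ge.
  near=> s; exists (x t) => _ [r /= hr <-]; move: hr; rewrite in_itv /= =>
    /andP[sr rt].
  apply: rode_le; last exact: ltW.
  apply: ltW; apply: le_lt_trans sr.
  by near: s; apply: nbhs_left_ge.
- apply/cvgryPge => M; have [t t0 xt] := rode_unbounded M.
  exists t; split; first exact: num_real.
  by move=> s ts; apply: (le_trans (ltW xt)); apply: rode_le => //; exact: ltW.
Unshelve. all: by end_near.
Qed.

(* While [x] stays below [y], a time [s] beyond [S / b + e] forces a speed of at
   least [n b e], so that [y] is left within a further [y / (n b e)]. *)
Lemma rode_time_le (y S e t : R) : 0 <= t -> x t = y -> 0 < e -> 0 <= S ->
  (forall z, 0 <= z <= y -> z - a * v z <= S) ->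
  t <= S / b + e + y / (n%:R * (b * e)).
Proof.
move=> t0 xt e0 S0 hS.
have be : 0 < b * e by rewrite mulr_gt0.
have nbe : 0 < n%:R * (b * e) by rewrite mulr_gt0.
pose s := S / b + e.
have y0 : 0 <= y by rewrite -xt x_ge0.
have s0 : 0 <= s by rewrite addr_ge0 ?divr_ge0 // ltW.
have bs : b * s = S + b * e by rewrite /s; field; rewrite gt_eqF.
have [ts|st] := leP t s.
  by apply: (le_trans ts); rewrite lerDl divr_ge0 // ltW.
have := @clamp_mean_value_ge R x G s t (n%:R * (b * e)) s0 (ltW st) dx.
have h1 : forall r, s < r -> r < t -> n%:R * (b * e) <= G r.
  move=> r sr rt; rewrite /G; apply: ler_wpDr; first exact: ltW.
  rewrite ler_pM2l //.
  have r0 : 0 <= r by lra.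
  have := hS (x r); rewrite x_ge0 //= -xt rode_le ?(ltW rt) // => /(_ isT).
  have : b * s <= b * r by rewrite ler_pM2l // ltW.
  by lra.
move=> /(_ h1); rewrite xt => h2.
have h3 : n%:R * (b * e) * (t - s) <= y by have := x_ge0 s0; lra.
rewrite -/s -lerBlDl ler_pdivlMr //; lra.
Qed.

(** At the time [s] when the level [z] is reached, the nonnegative speed reads
    [n * (b * s - (z - a * v z)) + c >= 0]. Solving for [s] gives the bound, and [s <= t] since
    [z <= y]. *)
Lemma rode_time_ge (y S t : R) : 0 <= t -> x t = y ->
  (exists2 z, 0 <= z <= y & S <= z - a * v z) -> 0 - a * v 0 <= 0 ->
  S / b - c / (n%:R * b) <= t.
Proof.
move=> t0 xt [z /andP[z0 zy] Sz] f0.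
have nb : 0 < n%:R * b by rewrite mulr_gt0.
have cnb : 0 < c / (n%:R * b) by rewrite divr_gt0.
have [s s0 xs] := rode_surjective z0.
have st : s <= t.
  by rewrite leNgt; apply/negP => /(rode_increasing t0); rewrite xs xt ltNge zy.
suff : S / b - c / (n%:R * b) <= s by lra.
(* The sign of the speed was established at positive times. For [s = 0] the level is [z = 0], and
   then [S <= 0]. *)
move: s0; rewrite le_eqVlt => /predU1P[s0|s0].
  move: Sz; rewrite -xs -s0 x0 => Sz.
  suff : S / b <= 0 by lra.
  by apply: mulr_le0_ge0; [lra|rewrite invr_ge0 ltW].
have := rode_drift_ge0 s0; rewrite xs => h.
have -> : S / b - c / (n%:R * b) = (n%:R * S - c) / (n%:R * b).
  by field; rewrite !gt_eqF.
rewrite ler_pdivrMr //.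
have : n%:R * S <= n%:R * (z - a * v z) by rewrite ler_pM2l.
by lra.
Qed.

End random_ode.

(** * First passage and convergence of the exit times *)

Section first_passage.
Context {R : realType}.
Variables (b : R) (f : R -> R).
Hypotheses (b_gt0 : 0 < b) (cf : continuous f) (f0 : f 0 = 0).
Hypothesis f_unbounded : forall K : R, exists2 y, 0 < y & K < f y.

Let A t := [set y | 0 < y /\ f y > b * t].

(** With [f y = y - a * v y] this is [fractional_inverse_gaussian]. *)
Definition first_passage t := inf (A t).

Local Notation Y := first_passage.

Let fE y e : 0 < e -> exists2 d, 0 < d & forall z, `|y - z| < d -> `|f y - f z| < e.
Proof.
move=> e0; have /cvgrPdist_lt/(_ _ e0)[d /= d0 hd] : f x @[x --> y] --> f y :=
  @cf y.
by exists d.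
Qed.

Let A_nonempty t : A t !=set0.
Proof. by have [y y0 hy] := f_unbounded (b * t); exists y. Qed.

Let A_lbound t : has_lbound (A t).
Proof. by exists 0 => y [/ltW]. Qed.

Let Y_le t y : 0 < y -> b * t < f y -> Y t <= y.
Proof. by move=> y0 hy; apply: ge_inf; [exact: A_lbound|split]. Qed.

Let Y_ge0 t : 0 <= Y t.
Proof. by apply: lb_le_inf; [exact: A_nonempty|move=> y [/ltW]]. Qed.

Let f_before t y : 0 <= t -> 0 <= y -> y < Y t -> f y <= b * t.
Proof.
move=> t0; rewrite le_eqVlt => /predU1P[<- _|y0 yY]; first by rewrite f0 mulr_ge0
  // ltW.
by rewrite leNgt; apply/negP => /(Y_le y0); rewrite leNgt yY.
Qed.

(** Since the inequality is strict at [y], continuity extends it a little beyond [y], where passage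
    is then still impossible. *)
Let lt_Y t y : 0 <= t -> 0 <= y -> (forall z, 0 <= z <= y -> f z < b * t) -> y <
  Y t.
Proof.
move=> t0 y0 H.
have hy := H y; rewrite y0 lexx in hy; have {}hy := hy isT.
have [|d d0 hd] := @fE y (b * t - f y); first by rewrite subr_gt0.
suff : y + d <= Y t by lra.
apply: lb_le_inf; [exact: A_nonempty|move=> z [z0 hz]]; rewrite leNgt; apply/negP
  => zd.
have [zy|yz] := leP z y; first by have := H z; rewrite (ltW z0) zy => /(_ isT);
  rewrite ltNge (ltW hz).
have := hd z; rewrite distrC gtr0_norm; last by rewrite subr_gt0.
move=> /(_ ltac:(lra)); rewrite distrC => h; have h3 := ler_norm (f z - f y). lra.
Qed.

(** A continuous [f] does not overshoot the level [b * t]. Distinct times thus have distinct passage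
    points, which makes [Y] strictly increasing. *)
Let f_Y t : 0 <= t -> f (Y t) = b * t.
Proof.
move=> t0; have bt0 : 0 <= b * t by rewrite mulr_ge0 // ltW.
have le1 : f (Y t) <= b * t.
  rewrite leNgt; apply/negP => h.
  have Yp : 0 < Y t.
    by rewrite lt_neqAle Y_ge0 andbT; apply/eqP => e; move: h; rewrite -e f0; lra.
  have [|d d0 hd] := @fE (Y t) (f (Y t) - b * t); first by rewrite subr_gt0.
  pose s := Num.max 0 (Y t - d / 2).
  have [s1 s2 s3] : [/\ 0 <= s, s < Y t & Y t - s < d].
    by rewrite /s; case: (leP 0 (Y t - d / 2)) => ?; split; lra.
  have := hd s; rewrite gtr0_norm; last lra.
  move=> /(_ s3) h2; have h3 := ler_norm (f (Y t) - f s); have h4 := f_before t0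
    s1 s2; lra.
apply/eqP; rewrite eq_le le1 leNgt; apply/negP => h.
have [|d d0 hd] := @fE (Y t) (b * t - f (Y t)); first by rewrite subr_gt0.
suff : Y t + d <= Y t by lra.
apply: lb_le_inf; [exact: A_nonempty|move=> z [z0 hz]]; rewrite leNgt; apply/negP
  => zd.
have Yz : Y t <= z := Y_le z0 hz.
have := hd z; rewrite distrC ger0_norm; last by rewrite subr_ge0.
move=> /(_ ltac:(lra)); rewrite distrC => h2; have h3 := ler_norm (f z - f (Y
  t)); lra.
Qed.

Let Y_increasing s t : 0 <= s -> s < t -> Y s < Y t.
Proof.
move=> s0 st; have t0 : 0 <= t by lra.
have bst : b * s < b * t by rewrite ltr_pM2l.
rewrite lt_neqAle; apply/andP; split.
  by apply/eqP => e; move: bst; rewrite -f_Y // -(f_Y t0) e ltxx.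
apply: lb_le_inf; [exact: A_nonempty|move=> y [y0 hy]]; apply: Y_le => //; lra.
Qed.

Let le_bounded (M : R) : 0 <= M ->
  exists z, [/\ 0 <= z, z <= M & forall y, 0 <= y <= M -> f y <= f z].
Proof.
move=> M0; have [|z] := @EVT_max R f 0 M M0; first exact: continuous_subspaceT.
rewrite in_itv /= => /andP[z0 zM] H; exists z.
by split=> // y yM; apply: H; rewrite in_itv.
Qed.

(** For right continuity, a point [y] just above [Y t] with [f y > b * t] also bounds [Y s] as long
    as [b * s < f y]. For the limit at infinity, [Y s] exceeds [M] once [b * s] exceeds the maximum
    of [f] on [[0, M]]. *)
Lemma first_passage_Phibar : Phibar Y.
Proof.
split.
- by move=> t _; exact: Y_ge0.
- exact: Y_increasing.
- move=> t t0; apply/cvgrPdist_lt => e e0.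
  have /inf_lt : inf (A t) < Y t + e by rewrite ltrDl.
  move=> /(_ (A_nonempty t))[y [y0 hy] ye].
  have d0 : 0 < f y / b - t by rewrite subr_gt0 ltr_pdivlMr // mulrC.
  exists (f y / b - t) => // s /= ts st.
  rewrite distrC gtr0_norm; last by rewrite subr_gt0 Y_increasing.
  have : Y s <= y.
    apply: Y_le => //; rewrite mulrC -ltr_pdivlMr //.
    by move: ts; rewrite distrC gtr0_norm ?subr_gt0 //; lra.
  by lra.
- move=> t t0; apply: nondecreasing_at_left_is_cvgr.
    near=> s; move=> r r'; rewrite !in_itv /= => /andP[sr _] _.
    rewrite le_eqVlt => /predU1P[->//|rr']; apply/ltW/Y_increasing => //.
    apply: ltW; apply: le_lt_trans sr; by near: s; apply: nbhs_left_ge.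
  near=> s; exists (Y t) => _ [r /= hr <-]; move: hr; rewrite in_itv /= =>
    /andP[sr rt].
  apply/ltW/Y_increasing => //.
  apply: ltW; apply: le_lt_trans sr; by near: s; apply: nbhs_left_ge.
- apply/cvgryPge => M.
  have [z [z0 zM hz]] := @le_bounded (Num.max M 0) (ltac:(by rewrite le_max lexx
    orbT)).
  exists (Num.max (f z / b) 0); split; first exact: num_real.
  move=> s; rewrite gt_max => /andP[fs s0].
  have : Num.max M 0 < Y s.
    apply: lt_Y => //; [exact: ltW|by rewrite le_max lexx orbT|].
    by move=> y /hz /le_lt_trans; apply; rewrite mulrC -ltr_pdivrMr.
  by move=> h; apply: ltW; apply: le_lt_trans h; rewrite le_max lexx.
Unshelve. all: by end_near.
Qed.

(** The point [z] maximises [f] on [[0, y]]. After the time [f z / b] the line [b * t] lies above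
    [f] on all of [[0, y]], so [Y t > y]; conversely [Y t > y] forces [f z <= b * t]. *)
Lemma first_passage_exit_time y : 0 <= y ->
  exists z, [/\ 0 <= z <= y, forall z', 0 <= z' <= y -> f z' <= f z
    & exit_time Y y = f z / b].
Proof.
move=> y0; have [z [z0 zy hz]] := le_bounded y0.
exists z; rewrite z0 zy; split=> //.
have fz0 : 0 <= f z by rewrite -f0 hz // lexx y0.
have later t : f z / b < t -> 0 < t /\ y < Y t.
  move=> zt; have t0 : 0 < t by apply: le_lt_trans zt; rewrite divr_ge0 // ltW.
  split=> //; apply: lt_Y => //; first exact: ltW.
  by move=> z' /hz /le_lt_trans; apply; rewrite mulrC -ltr_pdivrMr.
apply/eqP; rewrite eq_le; apply/andP; split; last first.
  apply: lb_le_inf; first by exists (f z / b + 1); apply: later; rewrite ltrDl.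
  move=> t [t0 yt]; rewrite ler_pdivrMr // mulrC.
  by apply: f_before => //; [exact: ltW|exact: le_lt_trans yt].
apply/ler_addgt0Pr => e e0; apply: ge_inf; first by exists 0 => t [/ltW].
by apply: later; rewrite ltrDl.
Qed.

End first_passage.

Lemma cvg_inv_sqrt (R : realType) (B : R) : 0 <= B ->
  (B / Num.sqrt n%:R) @[n --> \oo] --> 0.
Proof.
move=> B0; apply/cvgrPdist_lt => e e0.
pose N := (Num.truncn ((B / e) ^+ 2)).+1.
have /truncn_itv/andP[_ hN] : 0 <= (B / e) ^+ 2 by exact: sqr_ge0.
exists N => // n /= Nn.
have n0 : 0 < n%:R :> R by rewrite ltr0n (leq_trans _ Nn).
have s0 : 0 < Num.sqrt n%:R :> R by rewrite sqrtr_gt0.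
have Be : 0 <= B / e by rewrite divr_ge0 // ltW.
rewrite sub0r normrN ger0_norm ?divr_ge0 ?sqrtr_ge0 //.
rewrite ltr_pdivrMr // mulrC -ltr_pdivrMr // -(ger0_norm Be) -sqrtr_sqr ltr_sqrt //.
by apply: (lt_le_trans hN); rewrite ler_nat.
Qed.

(** * Rate of convergence along a fixed path *)

Section convergence.
Context {R : realType}.
Variables (a b c : R) (v : R -> R) (x : nat -> R -> R) (x0 : R -> R).
Hypotheses (b_gt0 : 0 < b) (c_gt0 : 0 < c).
Hypotheses (cv : continuous v) (v0 : v 0 = 0).
Hypothesis drift_unbounded : forall K : R, exists2 y, 0 < y & K < y - a * v y.
Hypothesis x_sol : forall n, (0 < n)%N -> solves_rode n a b c v (x n).
Hypothesis x0E : forall t, x0 t = fractional_inverse_gaussian a b v t.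

Let f y := y - a * v y.

Let x0_first_passage : x0 = first_passage b f.
Proof. by apply/funext => t; rewrite x0E. Qed.

Let f_continuous : continuous f.
Proof.
move=> y; apply: cvgB; first exact: cvg_id.
by apply: cvgMr; exact: cv.
Qed.

Let f0 : f 0 = 0. Proof. by rewrite /f v0 mulr0 subrr. Qed.

Let v_bounded (M : R) : exists C : R, forall y, 0 <= y <= M -> `|v y| <= C.
Proof.
have [M0|M0] := leP 0 M; last first.
  by exists 0 => y /andP[y0 /(le_trans y0)]; rewrite leNgt M0.
have cn : continuous (fun y => `|v y|) by move=> y; apply: cvg_norm; exact: cv.
have [|z _ hz] := @EVT_max R (fun y => `|v y|) 0 M M0; first exact:
  continuous_subspaceT.
by exists `|v z| => y yM; apply: hz; rewrite in_itv.
Qed.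

Lemma first_passage_path_Phibar : Phibar x0.
Proof. by rewrite x0_first_passage; exact: first_passage_Phibar. Qed.

(** The term [c / b] comes from [rode_time_ge]; the terms [1] and [b^-1] come from [rode_time_le]
    with [e] equal to the inverse square root of [n], which balances its two errors. *)
Let B : R := c / b + 1 + b^-1.

Let B_ge0 : 0 <= B.
Proof. by rewrite /B !addr_ge0 ?divr_ge0 ?invr_ge0 // ltW. Qed.

Lemma exit_time_difference_le n y : (0 < n)%N -> 0 <= y ->
  `|exit_time x0 y - exit_time (x n) y| <= B / Num.sqrt n%:R * (1 + y).
Proof.
move=> n0 y0.
have [t t0 xt] := rode_surjective n0 b_gt0 c_gt0 (x_sol n0) v_bounded y0.
have -> : exit_time (x n) y = t.
  by rewrite -xt; exact: (rode_exit_time n0 b_gt0 (x_sol n0)).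
have [z [zy hz]] := first_passage_exit_time b_gt0 f_continuous f0 drift_unbounded
  y0.
rewrite -/f -x0_first_passage => ->.
set s := Num.sqrt n%:R.
have n1 : 1 <= n%:R :> R by rewrite ler1n.
have s1 : 1 <= s by rewrite -[1]sqrtr1 ler_wsqrtr.
have s0 : 0 < s by exact: lt_le_trans s1.
have ns : n%:R = s ^+ 2 by rewrite sqr_sqrtr // ler0n.
have z0 : 0 <= f z by rewrite -f0 hz // lexx y0.
have up := rode_time_le n0 b_gt0 c_gt0 (x_sol n0) t0 xt (_ : 0 < s^-1) z0 hz.
have {}up := up (ltac:(by rewrite invr_gt0)).
have lo : f z / b - c / (n%:R * b) <= t.
  apply: (rode_time_ge n0 b_gt0 c_gt0 (x_sol n0) v_bounded t0 xt).
    by exists z.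
  by rewrite -/(f 0) f0.
have e1 : s^-1 + y / (n%:R * (b * s^-1)) = (1 + y / b) / s.
  by rewrite ns; field; rewrite !gt_eqF.
have e2 : c / (n%:R * b) <= c / b / s.
  rewrite -mulrA -invfM ler_wpM2l ?(ltW c_gt0) // lef_pV2 ?posrE ?mulr_gt0 //
    ?(lt_le_trans _ n1) //.
  by rewrite mulrC ler_pM2r // ns expr2 ler_peMl // ltW.
have yb : 0 <= y / b by rewrite divr_ge0 // ltW.
have cb : 0 <= c / b by rewrite divr_ge0 // ltW.
have cby : 0 <= c / b * y by rewrite mulr_ge0.
have b1 : 0 <= b^-1 by rewrite invr_ge0 ltW.
have h1 : (1 + y / b) / s <= B * (1 + y) / s.
  rewrite ler_pM2r ?invr_gt0 // /B.
  have -> : (c / b + 1 + b^-1) * (1 + y) = (1 + y / b) + (c / b + c / b * y + y +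
    b^-1) by field; rewrite gt_eqF.
  by rewrite lerDl !addr_ge0.
have h2 : c / b / s <= B * (1 + y) / s.
  rewrite ler_pM2r ?invr_gt0 // /B.
  have -> : (c / b + 1 + b^-1) * (1 + y) = c / b + (1 + y / b + c / b * y + y +
    b^-1) by field; rewrite gt_eqF.
  by rewrite lerDl !addr_ge0.
rewrite mulrAC ler_norml; move: up lo e1 e2 h1 h2.
move: (s^-1) (y / (n%:R * (b * s^-1))) (c / (n%:R * b)) (f z / b) => p1 p2 p3 p4.
move: ((1 + y / b) / s) (B * (1 + y) / s) (c / b / s) => p5 p6 p7.
by move=> up lo e1 e2 h1 h2; apply/andP; split; lra.
Qed.

Lemma dist_Phibar_le n : (0 < n)%N ->
  (dist_Phibar (x n) x0 <= (3 * B / Num.sqrt n%:R)%:E)%E.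
Proof.
move=> n0; rewrite -mulrA; apply: norm_Rplus_le_linear.
  by rewrite divr_ge0 // sqrtr_ge0.
by move=> y; exact: exit_time_difference_le.
Qed.

Lemma dist_Phibar_cvg : dist_Phibar (x n) x0 @[n --> \oo] --> 0%E.
Proof.
have B3 : 0 <= 3 * B by rewrite mulr_ge0.
apply: (@squeeze_cvge _ _ _ _ (fun=> 0%E) _ (fun n => (3 * B / Num.sqrt n%:R)%:E)).
- near=> n; apply/andP; split; first exact: norm_Rplus_ge0.
  by apply: dist_Phibar_le; near: n; exact: nbhs_infty_gt.
- exact: cvg_cst.
- by apply: cvg_EFin; [exact: nearW|exact: cvg_inv_sqrt].
Unshelve. all: by end_near.
Qed.

Lemma path_conclusion : [/\ Phibar x0,
  (forall n, (0 < n)%N ->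
    [/\ Phibar (x n), set_bij (@Rplus R) (@Rplus R) (x n) &
      dist_Phibar (x n) x0 =
      norm_Rplus (fun y => exit_time x0 y - inverse_Rplus (x n) y)]) &
  dist_Phibar (x n) x0 @[n --> \oo] --> 0%E].
Proof.
split; [exact: first_passage_path_Phibar| |exact: dist_Phibar_cvg].
move=> n n0; split.
- exact: (rode_Phibar n0 b_gt0 c_gt0 (x_sol n0) v_bounded).
- exact: (rode_bij n0 b_gt0 c_gt0 (x_sol n0) v_bounded).
apply: eq_norm_Rplus => y y0.
have [t t0 <-] := rode_surjective n0 b_gt0 c_gt0 (x_sol n0) v_bounded y0.
by rewrite (rode_exit_time n0 b_gt0 (x_sol n0)) // (rode_inverseE n0 b_gt0 c_gt0
  (x_sol n0) v_bounded).
Qed.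

End convergence.

(** * The fractional integral *)

Section fractional_integral.
Context {R : realType}.
Variables (al : R).
Hypotheses (al_gt0 : 0 < al) (al_lt1 : al < 1).
Local Notation mu := (@lebesgue_measure R).

Lemma lebesgue_measure_shift (k : R) (A : set R) : measurable A ->
  pushforward mu ((fun u => u + k) : _ -> measurableTypeR R) A = mu A.
Proof.
have mk : measurable_fun setT ((fun u => u + k) : measurableTypeR R ->
  measurableTypeR R).
  by apply: measurable_funD.
move=> mA; apply/esym/lebesgue_measure_unique => //= _ [[a b]] _ <-.
rewrite /pushforward.
have -> : (fun u => u + k) @^-1` `]a, b]%classic = `]a - k, b - k]%classic.
  by apply/seteqP; split=> u /=; rewrite !in_itv /= ltrBlDr lerBrDr.
rewrite !lebesgue_measure_itv /= !lte_fin ltrD2r.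
by case: ifP => // _; rewrite -!EFinD; congr EFin; ring.
Qed.

Lemma integrable_shift (f : R -> R) (k : R) : mu.-integrable setT (EFin \o f) ->
  mu.-integrable setT (EFin \o (fun u => f (u + k))).
Proof.
have mk : measurable_fun setT ((fun u => u + k) : measurableTypeR R ->
  measurableTypeR R).
  by apply: measurable_funD.
move=> /integrableP[mf fi]; apply/integrableP; split.
  exact: (measurableT_comp mf mk).
have := @ge0_integral_pushforward _ _ _ _ R _ mk mu setT (fun x => `|(f x)%:E|)%E
  measurableT.
rewrite preimage_setT => <- //; last exact: measurableT_comp.
rewrite (_ : (\int[_]_(_ in _) _)%E = \int[mu]_x `|(f x)%:E|)%E //.
by apply: eq_measure_integral => A mA _; exact: lebesgue_measure_shift.
Qed.

Lemma Rintegral_shift (f : R -> R) (k : R) : mu.-integrable setT (EFin \o f) ->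
  \int[mu]_u f (u + k) = \int[mu]_u f u.
Proof.
have mk : measurable_fun setT ((fun u => u + k) : measurableTypeR R ->
  measurableTypeR R).
  by apply: measurable_funD.
move=> fi; rewrite /Rintegral; congr fine.
have := @integral_pushforward _ _ _ _ R _ mk mu setT (EFin \o f).
rewrite preimage_setT => <- //; first last.
- exact: integrable_shift.
- by have /integrableP[] := fi.
by apply: eq_measure_integral => A mA _; exact: lebesgue_measure_shift.
Qed.

(** Extended by 0, the kernel turns the fractional integral into a convolution over the whole line,
    where translations are available. *)
Definition riesz_kernel (x : R) : R := if 0 < x then x `^ (- al) else 0.

Lemma riesz_kernel_ge0 x : 0 <= riesz_kernel x.
Proof. by rewrite /riesz_kernel; case: ifP => // _; exact: powR_ge0. Qed.

Lemma riesz_kernel_le0 x : x <= 0 -> riesz_kernel x = 0.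
Proof. by rewrite /riesz_kernel ltNge => ->. Qed.

Lemma riesz_kernel_nonincreasing x y : 0 < x -> x <= y -> riesz_kernel y <=
  riesz_kernel x.
Proof.
move=> x0 xy; have y0 : 0 < y by exact: lt_le_trans xy.
rewrite /riesz_kernel x0 y0 !powRN lef_pV2 ?posrE ?powR_gt0 //.
by apply: ge0_ler_powR; rewrite ?nnegrE // ltW.
Qed.

Lemma measurable_riesz_kernel : measurable_fun setT riesz_kernel.
Proof.
apply: measurable_fun_ifT; [exact: measurable_fun_ltr|exact:
  measurable_powR|exact: measurable_cst].
Qed.

(** The kernel decays too slowly to be integrable at minus infinity. The cut at [p] makes it an
    integrable majorant, since the paths vanish far to the left. *)
Definition cut_kernel (p z u : R) : R := if p <= u then riesz_kernel (z - u) else 0.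

Lemma cut_kernel_ge0 p z u : 0 <= cut_kernel p z u.
Proof. by rewrite /cut_kernel; case: ifP => // _; exact: riesz_kernel_ge0. Qed.

Lemma cut_kernel_shift p z k u : cut_kernel p z (u + k) = cut_kernel (p - k) (z -
  k) u.
Proof. by rewrite /cut_kernel lerBlDr; congr (if _ then riesz_kernel _ else _);
  ring. Qed.

Lemma cut_kernel_antimonotone p q z u : p <= q -> cut_kernel q z u <= cut_kernel
  p z u.
Proof.
move=> pq; rewrite /cut_kernel; case: ifPn => [qu|_]; last by case: ifP => // _;
  exact: riesz_kernel_ge0.
by rewrite (le_trans pq qu).
Qed.

Lemma measurable_cut_kernel p z : measurable_fun setT (cut_kernel p z).
Proof.
apply: measurable_fun_ifT; [exact: measurable_fun_ler| |exact: measurable_cst].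
by apply: (measurableT_comp measurable_riesz_kernel); exact: measurable_funB.
Qed.

Lemma integral_powR_itv (p q z : R) : p < q -> q < z ->
  (\int[mu]_(u in `[p, q]) ((z - u) `^ (- al))%:E =
   ((z - p) `^ (1 - al) / (1 - al) - (z - q) `^ (1 - al) / (1 - al))%:E)%E.
Proof.
move=> pq qz; have a1 : 1 - al != 0 by rewrite gt_eqF // subr_gt0.
pose F u := - ((z - u) `^ (1 - al) / (1 - al)).
have dF (u : R) : u < z -> is_derive u 1 F ((z - u) `^ (- al)).
  move=> uz; rewrite /F.
  have zu : 0 < z - u by rewrite subr_gt0.
  have h := is_derive1_powR (1 - al) zu.
  have h2 : is_derive u 1 (fun u => z - u) (- 1 : R).
    by apply: is_derive_eq; rewrite add0r mul1r.
  have h3 := @is_derive1_comp R ((powR (R:=R))^~ (1 - al)) (fun u : R => z - u) u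
    _ _ h h2.
  have h4 := is_deriveZ (- (1 - al)^-1) h3.
  have -> : (fun u => - ((z - u) `^ (1 - al) / (1 - al))) =
      (- (1 - al)^-1) \*: ((powR (R:=R))^~ (1 - al) \o (fun u : R => z - u)).
    by apply/funext => x; rewrite -mulrN mulrC.
  apply: (is_derive_eq h4).
  have -> : 1 - al - 1 = - al by ring.
  by rewrite /GRing.scale /=; field.
have dcF (u : R) : u < z -> F x @[x --> u] --> F u.
  move=> /dF h; apply: differentiable_continuous; apply/derivable1_diffP.
  exact: (@ex_derive _ _ _ _ _ _ _ h).
have cf : {within `[p, q], continuous (fun u => (z - u) `^ (- al))}.
  apply: continuous_in_subspaceT => u; rewrite inE /= in_itv /= => /andP[_ uq].
  have zu : 0 < z - u by rewrite subr_gt0 (le_lt_trans uq).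
  apply: (@continuous_comp _ _ _ (fun u => z - u) ((powR (R:=R))^~ (- al))).
    by apply: cvgB; [exact: cvg_cst|exact: cvg_id].
  apply: differentiable_continuous; apply/derivable1_diffP.
  exact: (@ex_derive _ _ _ _ _ _ _ (is_derive1_powR (- al) zu)).
rewrite (@continuous_FTC2 R _ F p q pq cf).
- by rewrite /F -EFinB; congr EFin; ring.
- split.
  + move=> u; rewrite in_itv /= => /andP[_ uq].
    exact: (@ex_derive _ _ _ _ _ _ _ (dF u (lt_trans uq qz))).
  + by apply: cvg_at_right_filter; apply: dcF; exact: lt_trans qz.
  + by apply: cvg_at_left_filter; exact: dcF.
- move=> u; rewrite in_itv /= => /andP[_ uq].
  by rewrite derive1E; have h := dF u (lt_trans uq qz); rewrite derive_val.
Qed.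

(** The singularity at [u = z] is approached by intervals [[p, q i]] on which the primitive is
    smooth, and monotone convergence passes to the limit. *)
Lemma integral_cut_kernel_le p z :
  (\int[mu]_u (cut_kernel p z u)%:E <= ((z - p) `^ (1 - al) / (1 - al))%:E)%E.
Proof.
have a1 : 0 < 1 - al by rewrite subr_gt0.
have B0 : 0 <= (z - p) `^ (1 - al) / (1 - al) by rewrite divr_ge0 ?powR_ge0 // ltW.
have [zp|pz] := leP z p.
  rewrite integral0_eq ?lee_fin // => u _; congr EFin; rewrite /cut_kernel; case:
    ifP => // pu.
  by apply: riesz_kernel_le0; rewrite subr_le0 (le_trans zp).
(* The denominator starts at 2 so that [p < q i] already for [i = 0]. *)
pose q i := z - (z - p) / i.+2%:R.
have zpi i : 0 < (z - p) / i.+2%:R by rewrite divr_gt0 // subr_gt0.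
have qz i : q i < z by rewrite /q ltrBlDr ltrDl.
have pq i : p < q i.
  rewrite /q ltrBrDr addrC -ltrBrDr ltr_pdivrMr ?ltr0n // ltr_pMr ?subr_gt0 //.
  by rewrite ltr1n.
have -> : (\int[mu]_u (cut_kernel p z u)%:E = \int[mu]_(u in \bigcup_i `[p, q
  i]%classic) ((z - u) `^ (- al))%:E)%E.
  rewrite [RHS]integral_mkcond; apply: eq_integral => u _; rewrite patchE
    /cut_kernel /riesz_kernel.
  case: ifPn => [pu|pu]; last first.
    rewrite ifN //; rewrite notin_setE => -[i _] /=; rewrite in_itv /= => /andP[h
      _].
    by rewrite h in pu.
  rewrite subr_gt0; case: ifPn => [uz|uz]; last first.
    rewrite ifN //; rewrite notin_setE => -[i _] /=; rewrite in_itv /= => /andP[_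
      h].
    by move: uz; rewrite (le_lt_trans h).
  rewrite ifT // inE.
  have zu : 0 < z - u by rewrite subr_gt0.
  have [i hi] : exists i : nat, (z - p) / (z - u) < i%:R.
    exists (Num.truncn ((z - p) / (z - u))).+1.
    have /truncn_itv/andP[] // : 0 <= (z - p) / (z - u).
    by rewrite divr_ge0 // ltW // subr_gt0.
  exists i => //=; rewrite in_itv /= pu /q lerBrDr addrC -lerBrDr.
  rewrite ler_pdivrMr ?ltr0n // mulrC -ler_pdivrMr //.
  by rewrite (le_trans (ltW hi)) // ler_nat -addn2 leq_addr.
have mg (D : set R) : measurable_fun D (fun u => ((z - u) `^ (- al))%:E).
  apply/measurable_EFinP; apply: measurable_funTS.
  by apply: (measurableT_comp (measurable_powR (- al))); exact: measurable_funB.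
have cv : (\int[mu]_(u in `[p, q i]) ((z - u) `^ (- al))%:E @[i --> \oo] -->
    \int[mu]_(u in \bigcup_i `[p, q i]%classic) ((z - u) `^ (- al))%:E)%E.
  apply: ge0_nondecreasing_set_cvg_integral => //; first last.
    by move=> i u _; rewrite lee_fin powR_ge0.
    by move=> i; exact: mg.
    move=> i j ij; apply/subsetPset => u /=; rewrite !in_itv /= => /andP[-> h] /=.
    apply: (le_trans h); rewrite /q lerD2l lerN2 ler_pM2l ?subr_gt0 //.
    by rewrite lef_pV2 ?posrE ?ltr0n // ler_nat !ltnS.
rewrite -(cvg_lim (@ereal_hausdorff R) cv).
apply: lime_le; first by apply/cvg_ex; eexists; exact: cv.
near=> i; rewrite integral_powR_itv // lee_fin lerBlDr lerDl.
by rewrite divr_ge0 ?powR_ge0 // ltW.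
Unshelve. all: by end_near.
Qed.

Lemma integrable_cut_kernel p z : mu.-integrable setT (EFin \o cut_kernel p z).
Proof.
apply/integrableP; split; first by apply/measurable_EFinP; exact:
  measurable_cut_kernel.
under eq_integral do rewrite /= ger0_norm ?cut_kernel_ge0 //.
by apply: le_lt_trans (integral_cut_kernel_le p z) _; rewrite ltry.
Qed.

Lemma Rintegral_cut_kernel_le p z :
  \int[mu]_u cut_kernel p z u <= (z - p) `^ (1 - al) / (1 - al).
Proof.
rewrite -lee_fin /Rintegral fineK; first exact: integral_cut_kernel_le.
exact: integrable_fin_num (integrable_cut_kernel p z).
Qed.

End fractional_integral.

Lemma continuous_bounded_left (R : realType) (f : R -> R) (N : R) :
  continuous (clamp f) -> exists2 M, 0 <= M & forall s, s <= N -> `|clamp f s| <= M.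
Proof.
move=> cf.
have m0 : 0 <= Num.max N 0 by rewrite le_max lexx orbT.
have cn : continuous (fun s => `|clamp f s|) by move=> s; apply: cvg_norm; exact:
  cf.
have [|z _ hz] := @EVT_max R (fun s => `|clamp f s|) 0 (Num.max N 0) m0.
  exact: continuous_subspaceT.
exists `|clamp f z| => // s sN.
have -> : clamp f s = clamp f (Num.max s 0) by rewrite /clamp -maxA maxxx.
apply: hz; rewrite in_itv /= le_max lexx orbT /= ge_max le_max sN /=.
exact: m0.
Qed.

(** * Differences of the fractional integral of a path *)

Section fractional_integral_path.
Context {R : realType}.
Variables (al : R) (w : R -> R).
Hypotheses (al_gt0 : 0 < al) (al_lt1 : al < 1).
Hypotheses (w0 : w 0 = 0) (cw : continuous (clamp w)).
Local Notation mu := (@lebesgue_measure R).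
Local Notation riesz_kernel := (riesz_kernel al).
Local Notation cut_kernel := (cut_kernel al).

Definition frac_int (z : R) : R := \int[mu]_(u in `[0, z]) (w u / (z - u) `^ al).

Local Notation F := frac_int.

Let we0 (s : R) : s <= 0 -> clamp w s = 0.
Proof. by move=> s0; rewrite /clamp max_r. Qed.

Let a1 : 0 < 1 - al. Proof. by rewrite subr_gt0. Qed.

Lemma frac_intE z : F z = \int[mu]_u (clamp w u * riesz_kernel (z - u)).
Proof.
rewrite /F Rintegral_mkcond; apply: eq_Rintegral => u _; rewrite patchE.
case: ifPn; rewrite ?inE ?notin_setE /= in_itv /=.
  move=> /andP[u0 uz]; rewrite clampE //; congr (_ * _).
  (* At [u = z] the quotient divides by zero and is 0 by convention, in agreement with the kernel at
     0. *)
  move: uz; rewrite le_eqVlt => /predU1P[->|uz].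
    by rewrite subrr powR0 ?gt_eqF // invr0 riesz_kernel_le0.
  by rewrite /riesz_kernel subr_gt0 uz powRN.
move=> /negP; rewrite negb_and -!ltNge => /orP[u0|zu].
  by rewrite we0 ?mul0r // ltW.
by rewrite riesz_kernel_le0 ?mulr0 // subr_le0 ltW.
Qed.

Let integrable_le_tail (f : R -> R) (M p z : R) : measurable_fun setT f ->
  (forall u, `|f u| <= M * cut_kernel p z u) -> mu.-integrable setT (EFin \o f).
Proof.
move=> mf hf.
apply: (@le_integrable _ _ _ mu setT measurableT _ (EFin \o (fun u => M *
  cut_kernel p z u))).
- exact/measurable_EFinP.
- by move=> u _ /=; rewrite lee_fin (le_trans (hf u)) // ler_norm.
- have -> : EFin \o (fun u => M * cut_kernel p z u) = (fun u => (M%:E * (EFin \o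
    cut_kernel p z) u)%E).
    by apply/funext => u /=; rewrite EFinM.
  by apply: integrableZl => //; exact: integrable_cut_kernel.
Qed.

Let Rintegral_le_tail (f : R -> R) (M p z : R) : 0 <= M -> measurable_fun setT f ->
  (forall u, `|f u| <= M * cut_kernel p z u) ->
  `|\int[mu]_u f u| <= M * ((z - p) `^ (1 - al) / (1 - al)).
Proof.
move=> M0 mf hf; have fi := integrable_le_tail mf hf.
apply: (le_trans (le_normr_Rintegral measurableT fi)).
apply: (@le_trans _ _ (\int[mu]_u (M * cut_kernel p z u))).
  apply: le_Rintegral => //.
  - apply: (@integrable_le_tail _ M p z) => [|u]; last by rewrite normr_id.
    exact: measurableT_comp.
  - apply: (@integrable_le_tail _ M p z) => [|u].
      by apply: measurable_funM => //; exact: measurable_cut_kernel.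
    by rewrite ger0_norm // mulr_ge0 // cut_kernel_ge0.
rewrite RintegralZl //; last exact: integrable_cut_kernel.
by apply: ler_wpM2l => //; exact: Rintegral_cut_kernel_le.
Qed.

Let measurable_we (h : R) : measurable_fun setT (fun u : R => clamp w (u + h)).
Proof.
have mw : measurable_fun setT (clamp w) by exact: continuous_measurable_fun.
by apply: (measurableT_comp mw); exact: measurable_funD.
Qed.

Let measurable_riesz_kernelB (z : R) : measurable_fun setT (fun u : R =>
  riesz_kernel (z - u)).
Proof. by apply: (measurableT_comp (measurable_riesz_kernel al)); exact:
  measurable_funB. Qed.

(** Translating the variable moves a shift of the argument of [F] from the kernel to the path, so
    that increments of [F] become integrals of increments of [w] against a fixed kernel. *)
Let conv (h z u : R) := clamp w (u + h) * riesz_kernel (z - u).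

Let measurable_conv h z : measurable_fun setT (conv h z).
Proof. exact: measurable_funM. Qed.

Let conv_le M h z : 0 <= M -> (forall s, s <= z + h -> `|clamp w s| <= M) ->
  forall u, `|conv h z u| <= M * cut_kernel (- h) z u.
Proof.
move=> M0 hM u; rewrite /conv /cut_kernel normrM (ger0_norm (riesz_kernel_ge0 _ _)).
case: ifPn => hu; last first.
  by rewrite we0 ?normr0 ?mul0r ?mulr0 //; move: hu; rewrite -ltNge; lra.
have [uz|zu] := leP u z; first by rewrite ler_wpM2r ?riesz_kernel_ge0 // hM //
  lerD2r.
by rewrite riesz_kernel_le0 ?mulr0 //; lra.
Qed.

Let integrable_conv h z : mu.-integrable setT (EFin \o conv h z).
Proof.
have [M M0 hM] := continuous_bounded_left (z + h) cw.
exact: integrable_le_tail (measurable_conv h z) (conv_le M0 hM).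
Qed.

Let frac_int_conv z k : F (z + k) = \int[mu]_u conv k z u.
Proof.
rewrite frac_intE -(@Rintegral_shift R _ k).
  by apply: eq_Rintegral => u _; rewrite /conv; congr (_ * riesz_kernel _); ring.
have := integrable_conv 0 (z + k); congr (mu.-integrable _ _).
by apply/funext => u; rewrite /conv /= addr0.
Qed.

Let frac_int_conv0 z : F z = \int[mu]_u conv 0 z u.
Proof. by rewrite -frac_int_conv addr0. Qed.

Let integrable_difference z k : mu.-integrable setT
  (EFin \o (fun u => conv k z u - conv 0 z u)).
Proof. exact: integrableB (integrable_conv k z) (integrable_conv 0 z). Qed.

Let frac_int_difference z k : F (z + k) - F z = \int[mu]_u (conv k z u - conv 0 z
  u).
Proof.
rewrite frac_int_conv [F z]frac_int_conv0.
by rewrite (RintegralB measurableT (integrable_conv _ _) (integrable_conv _ _)).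
Qed.

Lemma frac_int_bound M z : 0 <= M -> (forall s, 0 <= s <= z -> `|w s| <= M) ->
  `|F z| <= M * (z `^ (1 - al) / (1 - al)).
Proof.
move=> M0 hM; rewrite frac_int_conv0.
have -> : z `^ (1 - al) = (z - (- 0)) `^ (1 - al) by congr (_ `^ _); ring.
apply: Rintegral_le_tail => // u; apply: conv_le => // s; rewrite addr0 => sz.
have [s0|s0] := leP s 0; first by rewrite we0 // normr0.
by rewrite (clampE _ (ltW s0)) hM // sz ltW.
Qed.

Lemma frac_int_first_difference D p z k : 0 <= D -> 0 <= k -> p <= - k ->
  (forall s, s <= z -> `|clamp w (s + k) - clamp w s| <= D) ->
  `|F (z + k) - F z| <= D * ((z - p) `^ (1 - al) / (1 - al)).
Proof.
move=> D0 k0 pk hD; rewrite frac_int_difference.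
apply: Rintegral_le_tail => //; first exact: measurable_funB.
move=> u; rewrite /conv addr0 -mulrBl normrM (ger0_norm (riesz_kernel_ge0 _ _))
  /cut_kernel.
case: ifPn => hu; last first.
  by rewrite !we0 ?subrr ?normr0 ?mul0r ?mulr0 //; move: hu; rewrite -ltNge; lra.
have [uz|zu] := leP u z; first by rewrite ler_wpM2r ?riesz_kernel_ge0 // hD.
by rewrite riesz_kernel_le0 ?mulr0 //; lra.
Qed.

(* The two differences are distributed over the path and the kernel, which leaves
   the integral of the increment of a monotone kernel. *)
Lemma frac_int_second_difference D z k : 0 <= D -> 0 <= k ->
  (forall s, s <= z + k -> `|clamp w (s + k) - clamp w s| <= D) ->
  `|F (z + 2 * k) - 2 * F (z + k) + F z| <= D * (2 * (k `^ (1 - al) / (1 - al))).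
Proof.
move=> D0 k0 hD.
pose g u := (clamp w (u + k) - clamp w u) * (riesz_kernel (z + k - u) -
  riesz_kernel (z - u)).
(* For [u >= - k], [d] is the absolute value of the kernel increment: left of [z] the kernel at [z]
   dominates, and right of [z] only the kernel at [z + k] survives, where the factor 2 reverses its
   sign. *)
pose d u := 2 * cut_kernel z (z + k) u + cut_kernel (- k) z u - cut_kernel (- k)
  (z + k) u.
have gd u : `|g u| <= D * d u.
  have [uk|ku] := ltP u (- k).
    have -> : g u = 0 by rewrite /g !we0 ?subrr ?mul0r //; lra.
    have t0 q : cut_kernel (- k) q u = 0 by rewrite /cut_kernel leNgt uk.
    by rewrite normr0 mulr_ge0 // /d !t0 subr0 addr0 mulr_ge0 // cut_kernel_ge0.
  have [uz|zu] := ltP u z.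
    have t1 : cut_kernel z (z + k) u = 0 by rewrite /cut_kernel leNgt uz.
    rewrite /d t1 mulr0 add0r /cut_kernel ku normrM [X in _ * X]distrC.
    have dk : 0 <= riesz_kernel (z - u) - riesz_kernel (z + k - u).
      by rewrite subr_ge0; apply: riesz_kernel_nonincreasing => //; lra.
    by rewrite (ger0_norm dk) ler_wpM2r // hD //; lra.
  have k1 : riesz_kernel (z - u) = 0 by rewrite riesz_kernel_le0 // subr_le0.
  have -> : d u = riesz_kernel (z + k - u).
    by rewrite /d /cut_kernel zu ku k1; ring.
  rewrite /g k1 subr0 normrM (ger0_norm (riesz_kernel_ge0 _ _)).
  have [uzk|zku] := leP u (z + k); first by rewrite ler_wpM2r ?riesz_kernel_ge0
    // hD.
  by rewrite riesz_kernel_le0 ?mulr0 //; lra.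
have Fg : F (z + 2 * k) - 2 * F (z + k) + F z = \int[mu]_u g u.
  have -> : F (z + 2 * k) - 2 * F (z + k) + F z =
      (F (z + k + k) - F (z + k)) - (F (z + k) - F z).
    have -> : z + 2 * k = z + k + k by ring.
    by move: (F _) (F (z + k)) (F z) => x y t; ring.
  rewrite (f_equal2 (fun x y : R => x - y) (frac_int_difference (z + k) k)
    (frac_int_difference z k)).
  rewrite -(RintegralB measurableT (integrable_difference _ _)
    (integrable_difference _ _)).
  by apply: eq_Rintegral => u _; rewrite /g /conv !addr0; ring.
have it p q : mu.-integrable setT (EFin \o cut_kernel p q) by exact:
  integrable_cut_kernel.
have it2 : mu.-integrable setT (EFin \o (fun u => 2 * cut_kernel z (z + k) u)).
  have -> : EFin \o (fun u => 2 * cut_kernel z (z + k) u) = (fun u => (2%:E *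
    (EFin \o cut_kernel z (z + k)) u)%E).
    by apply/funext => u /=; rewrite EFinM.
  exact: integrableZl.
have it3 : mu.-integrable setT (EFin \o (fun u => 2 * cut_kernel z (z + k) u +
  cut_kernel (- k) z u)).
  have := integrableD measurableT it2 (it (- k) z); congr (mu.-integrable _ _).
have id : mu.-integrable setT (EFin \o d).
  have := integrableB measurableT it3 (it (- k) (z + k)); congr (mu.-integrable _
    _).
have iDd : mu.-integrable setT (EFin \o (fun u => D * d u)).
  have -> : EFin \o (fun u => D * d u) = (fun u => (D%:E * (EFin \o d) u)%E).
    by apply/funext => u /=; rewrite EFinM.
  exact: integrableZl.
have mg : measurable_fun setT g.
  apply: measurable_funM; apply: measurable_funB => //.
  exact: continuous_measurable_fun.
have ig : mu.-integrable setT (EFin \o g).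
  apply: (le_integrable measurableT _ _ iDd); first exact/measurable_EFinP.
  by move=> u _ /=; rewrite lee_fin (le_trans (gd u)) // ler_norm.
rewrite Fg; apply: (le_trans (le_normr_Rintegral measurableT ig)).
apply: (@le_trans _ _ (\int[mu]_u (D * d u))).
  apply: le_Rintegral => //.
  apply: (le_integrable measurableT _ _ ig); last by move=> u _ /=; rewrite
    lee_fin normr_id.
  by apply/measurable_EFinP; exact: measurableT_comp.
rewrite RintegralZl //; apply: ler_wpM2l => //.
rewrite RintegralB // RintegralD // RintegralZl //.
(* By translation, the last two terms of [d] have a nonpositive total integral. Only the integral of
   the kernel over an interval of length [k] remains, taken twice. *)
have sh : \int[mu]_u cut_kernel (- k) z u = \int[mu]_u cut_kernel 0 (z + k) u.
  etransitivity; last exact: (Rintegral_shift k (it 0 (z + k))).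
  by apply: eq_Rintegral => u _; rewrite cut_kernel_shift sub0r addrK.
have le2 : \int[mu]_u cut_kernel 0 (z + k) u <= \int[mu]_u cut_kernel (- k) (z +
  k) u.
  apply: (le_Rintegral measurableT (it _ _) (it _ _)) => u _.
  by apply: cut_kernel_antimonotone; rewrite oppr_le0.
have le1 := @Rintegral_cut_kernel_le R al al_lt1 z (z + k).
have zk : z + k - z = k by ring.
rewrite zk in le1.
rewrite sh -addrA; apply: (@le_trans _ _ (2 * \int[mu]_u cut_kernel z (z + k) u)).
  by rewrite gerDl subr_le0.
by rewrite ler_pM2l.
Qed.

End fractional_integral_path.

(** * Smoothness and growth of the fractional integral *)

Section fractional_integral_derivative.
Context {R : realType}.
Variables (al : R) (w : R -> R).
Hypotheses (al_gt0 : 0 < al) (al_lt1 : al < 1).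
Hypotheses (w0 : w 0 = 0) (cw : continuous (clamp w)).
Local Notation F := (frac_int al w).
Let a1 : 0 < 1 - al. Proof. by rewrite subr_gt0. Qed.

Variable lam : R.
Hypothesis al_lam : al < lam.
Hypothesis w_holder : forall N : R, exists2 C, 0 <= C & forall s k, s <= N -> 0
  <= k <= 1 ->
  `|clamp w (s + k) - clamp w s| <= C * k `^ lam.

Let lam_gt0 : 0 < lam. Proof. exact: lt_trans al_lam. Qed.

Lemma continuous_frac_int : continuous F.
Proof.
move=> z0; apply/cvgrPdist_le => e e0.
have [C C0 hC] := w_holder (z0 + 1).
(* The cut [- |z0| - 3] lies left of [- k] for all steps [k <= 1], and [X] bounds its distance from
   every [z <= z0 + 1]. The step [d] below solves [B * d^lam = e], where [C + 1] in place of [C]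
   keeps [B] positive. *)
pose X := z0 + `|z0| + 4.
have z0n : - `|z0| <= z0 by have := ler_norm (- z0); rewrite normrN; lra.
have X0 : 0 < X by rewrite /X; have := ler_norm z0; lra.
pose B := (C + 1) * (X `^ (1 - al) / (1 - al)).
have B0 : 0 < B by rewrite mulr_gt0 ?divr_gt0 ?powR_gt0 //; lra.
pose d := (e / B) `^ lam^-1.
have d0 : 0 < d by rewrite powR_gt0 // divr_gt0.
have key z k : z0 - 1 < z -> z <= z0 + 1 -> 0 <= k -> k <= d -> k <= 1 ->
    `|F (z + k) - F z| <= e.
  move=> z1 z2 k0 kd k1.
  have kl : k `^ lam <= e / B.
    have -> : e / B = d `^ lam.
      by rewrite /d -powRrM mulVf ?gt_eqF // powRr1 // divr_ge0 // ltW.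
    by apply: ge0_ler_powR; rewrite ?nnegrE // ltW.
  have zp : 0 <= z - (- `|z0| - 3) by lra.
  apply: (le_trans (@frac_int_first_difference R al w al_gt0 al_lt1 w0 cw (C * k
    `^ lam) (- `|z0| - 3) z k _ k0 _ _)).
  - by rewrite mulr_ge0 // powR_ge0.
  - by have := normr_ge0 z0; lra.
  - by move=> s sz; apply: hC; rewrite ?k0 ?k1 //; lra.
  have zX : (z - (- `|z0| - 3)) `^ (1 - al) <= X `^ (1 - al).
    apply: ge0_ler_powR; rewrite ?nnegrE ?(ltW a1) ?(ltW X0) //.
    by rewrite /X; lra.
  apply: (@le_trans _ _ ((C + 1) * (e / B) * (X `^ (1 - al) / (1 - al)))).
    apply: ler_pM.
    - by rewrite mulr_ge0 // powR_ge0.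
    - by rewrite divr_ge0 ?powR_ge0 // ltW.
    - by apply: ler_pM; rewrite ?powR_ge0 // lerDl.
    - by rewrite ler_pM2r ?invr_gt0.
  rewrite le_eqVlt; apply/orP; left; apply/eqP.
  rewrite mulrAC -/B mulrC -mulrA mulVf ?mulr1 //; exact: lt0r_neq0.
exists (Num.min d 1) => [|z /= zd]; first by rewrite /= lt_min d0 ltr01.
move: zd; rewrite lt_min => /andP[zd z1].
have [z0z|zz0] := leP z0 z.
  have e1 : z = z0 + (z - z0) by ring.
  rewrite distrC ger0_norm ?subr_ge0 // in zd; rewrite distrC ger0_norm ?subr_ge0
    // in z1.
  rewrite distrC [in F z]e1.
  by apply: key; rewrite ?subr_ge0 ?gtrBl ?lerDl // ltW.
have e1 : z0 = z + (z0 - z) by ring.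
rewrite gtr0_norm ?subr_gt0 // in zd; rewrite gtr0_norm ?subr_gt0 // in z1.
rewrite [in F z0]e1; apply: key; rewrite ?subr_ge0 ?(ltW zz0) ?(ltW zd) ?(ltW z1)
  //.
  by lra.
by lra.
Qed.

(** For [h = 2^-n] the second difference is at most a constant times [h^lam * h^(1 - al) = h * r^n],
    where [r < 1] because [al < lam]. *)
Lemma frac_int_C1 : exists g : R -> R, [/\ continuous g, g 0 = 0 &
  forall z : R, is_derive z 1 F (g z)].
Proof.
pose r : R := 2^-1 `^ (lam - al).
have h0 : 0 < (2^-1 : R) by rewrite invr_gt0.
have r0 : 0 < r by rewrite powR_gt0.
have r1 : r < 1 by rewrite powR_half_lt1 // subr_gt0.
have [] := @C1_of_second_differences R F r r0 r1 continuous_frac_int.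
  move=> N; have [C C0 hC] := w_holder (N + 1).
  exists (C * (2 / (1 - al))) => z n zN.
  have q0 : 0 < (2^-1 : R) ^+ n by rewrite exprn_gt0.
  have q1 : (2^-1 : R) ^+ n <= 1 by rewrite exprn_ile1 ?(ltW h0) // invf_le1 //
    ler1n.
  apply: (le_trans (@frac_int_second_difference R al w al_gt0 al_lt1 w0 cw (C *
    ((2^-1) ^+ n) `^ lam) z ((2^-1) ^+ n) _ (ltW q0) _)).
  - by rewrite mulr_ge0 // powR_ge0.
  - move=> s sz; apply: hC; last by rewrite (ltW q0).
    by apply: (le_trans sz); rewrite lerD.
  rewrite le_eqVlt; apply/orP; left; apply/eqP.
  have -> : C * (2^-1 ^+ n) `^ lam * (2 * ((2^-1 ^+ n) `^ (1 - al) / (1 - al))) =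
      C * (2 / (1 - al)) * ((2^-1 ^+ n) `^ lam * (2^-1 ^+ n) `^ (1 - al)).
    by move: (_ `^ lam) (_ `^ (1 - al)) => x y; ring.
  rewrite -powRD; last by rewrite (gt_eqF q0) implybT.
  have -> : lam + (1 - al) = 1 + (lam - al) by ring.
  rewrite powRD; last by rewrite (gt_eqF q0) implybT.
  by rewrite powRr1 ?(ltW q0) // powR_exprn ?(ltW h0) // -/r mulrA.
move=> g [cg dg]; exists g; split=> //.
(* The value of [g] at 0 is found from the left, where [F] and hence its difference quotients
   vanish. *)
have F0 z : z <= 0 -> F z = 0.
  move=> z0; apply/normr0_eq0/le_anti; rewrite normr_ge0 andbT.
  rewrite -[leRHS](mul0r (z `^ (1 - al) / (1 - al))); apply: frac_int_bound => //
    s /andP[s0 sz].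
  have -> : s = 0 by apply/le_anti; rewrite s0 (le_trans sz).
  by rewrite w0 normr0.
have [ex dv] := dg 0.
have cv : h^-1 *: (F (h *: 1 + 0) - F 0) @[h --> 0^'] --> g 0 by rewrite -dv.
apply/normr0_eq0/le_anti; rewrite normr_ge0 andbT.
apply/ler_addgt0Pr => e e0; rewrite add0r.
have /cvgrPdist_lt/(_ _ e0)[d /= d0 hd] := cv.
have := hd (- (d / 2)); rewrite /= sub0r opprK gtr0_norm; last by rewrite divr_gt0.
rewrite gtr_pMr // invf_lt1 // ltr1n => /(_ isT).
rewrite oppr_eq0 gt_eqF ?divr_gt0 // => /(_ isT).
rewrite !F0 //; last by rewrite addr0 /GRing.scale /= mulr1 oppr_le0 divr_ge0 //
  ltW.
by rewrite subrr scaler0 subr0 => /ltW.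
Qed.

(* Otherwise [a * (G * g y) >= y - K], so that [F] would grow quadratically. *)
Lemma frac_int_drift_unbounded (g : R -> R) (a G B dl : R) :
  (forall z : R, is_derive z 1 F (g z)) -> 0 < dl ->
  (forall J : nat, `|F J%:R| <= B * J%:R * (J.+1%:R) `^ (1 - dl)) ->
  forall K : R, exists2 y, 0 < y & K < y - a * (G * g y).
Proof.
move=> dF dl0 hB K0; apply: contrapT => H0.
pose K := Num.max K0 0.
have K_ge0 : 0 <= K by rewrite le_max lexx orbT.
have H y : 0 < y -> y - a * (G * g y) <= K.
  move=> y0; rewrite le_max; apply/orP; left; rewrite leNgt; apply/negP => h.
  by apply: H0; exists y.
have B0 : 0 <= B.
  have := hB 1%N; rewrite mulr1 => h; have := le_trans (normr_ge0 _) h.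
  by rewrite pmulr_lge0 // powR_gt0.
have F0 : F 0 = 0.
  by apply/eqP; rewrite -normr_le0 (le_trans (hB 0%N)) // mulr0 mul0r.
have main (J : nat) : (0 < J)%N -> J%:R / 2 - K <= `|a * G| * B * (J.+1%:R) `^ (1
  - dl).
  move=> J0; have JR : 0 < J%:R :> R by rewrite ltr0n.
  (* The assumed bound [K] makes the derivative of [L] nonnegative on positive arguments, so [L] is
     nonnegative at [J]. *)
  pose L (z : R) := (a * G) *: F z - (z ^+ 2 / 2 - K * z).
  have dL (z : R) : is_derive z 1 L (a * G * g z - (z - K)).
    have h1 := is_deriveZ (a * G) (dF z).
    have h2 : is_derive z 1 (fun z : R => z ^+ 2 / 2 - K * z) (z - K).
      by apply: is_derive_eq; rewrite /GRing.scale /=; field.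
    exact: (is_deriveB h1 h2).
  have cL : continuous L.
    move=> z; apply: differentiable_continuous; apply/derivable1_diffP.
    exact: (@ex_derive _ _ _ _ _ _ _ (dL z)).
  have [t] := @MVT R L _ 0 J%:R JR (fun z _ => dL z) (continuous_subspaceT cL).
  rewrite in_itv /= => /andP[t0 tJ]; rewrite subr0.
  have -> : L 0 = 0 by rewrite /L F0 /GRing.scale /= mulr0 expr0n /= mul0r mulr0
    !subr0.
  rewrite subr0 => LJ.
  have : 0 <= L J%:R.
    rewrite LJ mulr_ge0 ?(ltW JR) //; have := H t t0.
    by rewrite mulrA; move: (_ * g t) => x; lra.
  rewrite /L subr_ge0 /GRing.scale /= => h.
  rewrite -(ler_pM2r JR).
  have e1 : (J%:R / 2 - K) * J%:R = J%:R ^+ 2 / 2 - K * J%:R by field.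
  rewrite e1; apply: (le_trans h); apply: (le_trans (ler_norm _)); rewrite normrM.
  apply: (@le_trans _ _ (`|a * G| * (B * J%:R * (J.+1%:R) `^ (1 - dl)))).
    by apply: ler_wpM2l.
  by rewrite le_eqVlt; apply/orP; left; apply/eqP; move: (_ `^ _) => x; ring.
pose A := `|a * G| * B + 1.
have A0 : 0 < A by rewrite ltr_wpDl // mulr_ge0.
have p0 : 0 <= (4 * A) `^ dl^-1 by exact: powR_ge0.
(* The first term gives [x^dl >= 4 A] for [x = J + 1 > X], so that the right-hand side of [main] is
   at most [x / 4]. Then [main] would imply [x <= 4 K + 2], which the other terms exclude. *)
pose X := (4 * A) `^ dl^-1 + 4 * K + 4.
have X0 : 0 <= X by rewrite /X; lra.
have /truncn_itv/andP[_ hJ] := X0.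
set J := Num.truncn X in hJ.
have J0 : (0 < J)%N.
  by rewrite truncn_ge_nat // /X; lra.
have := main J J0.
set x := J.+1%:R in hJ *.
have xJ : J%:R = x - 1 by rewrite /x -natr1 addrK.
have x0 : 0 < x by rewrite ltr0n.
rewrite powRD; last by rewrite (gt_eqF x0) implybT.
rewrite powRr1 ?(ltW x0) // powRN.
have xd : 4 * A <= x `^ dl.
  have -> : 4 * A = ((4 * A) `^ dl^-1) `^ dl.
    by rewrite -powRrM mulVf ?gt_eqF // powRr1 // mulr_ge0 // ltW.
  apply: ge0_ler_powR; rewrite ?nnegrE ?(ltW dl0) ?(ltW x0) //.
  by move: hJ; rewrite /X; lra.
have A40 : 0 < 4 * A by rewrite mulr_gt0.
have h1 : `|a * G| * B * (x * (x `^ dl)^-1) <= x / 4.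
  apply: (@le_trans _ _ (A * (x * (4 * A)^-1))).
    apply: ler_pM; rewrite ?mulr_ge0 ?invr_ge0 ?powR_ge0 ?(ltW x0) //.
      by rewrite /A lerDl.
    by rewrite ler_pM2l // lef_pV2 ?posrE // powR_gt0.
  by rewrite le_eqVlt; apply/orP; left; apply/eqP; field; rewrite gt_eqF.
move=> /le_trans/(_ h1); rewrite xJ.
by move: hJ; rewrite /X; lra.
Qed.

End fractional_integral_derivative.

(** * Increments of Brownian motion *)

Section normal_tail.
Context {R : realType}.
Local Notation mu := (@lebesgue_measure R).

(** This is the [p]-th power of the inequality [expR (u / p) >= u / p], inverted. *)
Lemma expRN_le_pow (p : nat) (u : R) : 0 < u ->
  expR (- u) <= (p%:R / u) ^+ p.
Proof.
move=> u0; case: p => [|p]; first by rewrite expr0 -expR0 ler_expR oppr_le0 ltW.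
have p0 : 0 < p.+1%:R :> R by rewrite ltr0n.
have -> : - u = (- (u / p.+1%:R)) * p.+1%:R by field; rewrite gt_eqF.
rewrite expRM_natr; apply: lerXn2r; rewrite ?nnegrE ?expR_ge0 //.
  by rewrite divr_ge0 // ltW.
rewrite expRN -[leRHS]invrK lef_pV2 ?posrE ?invr_gt0 ?divr_gt0 ?expR_gt0 //.
rewrite invf_div; apply: le_trans (expR_ge1Dx _).
by rewrite lerDr.
Qed.

Lemma measurable_gt_norm (y : R) : measurable [set x : R | y < `|x|].
Proof.
have mn : measurable_fun setT (fun x : R => `|x|) by exact: measurableT_comp.
have -> : [set x : R | y < `|x|] = setT `&` (fun x : R => `|x|) @^-1` `]y,
  +oo[%classic.
  by apply/seteqP; split=> x /=; rewrite in_itv /= andbT //; case.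
exact: mn.
Qed.

(** Half of the Gaussian exponent is kept and forms the density of twice the variance, whose
    normalisation costs [Num.sqrt 2]. The other half is bounded by a power through [expRN_le_pow],
    so the tail estimate needs no moments. *)
Lemma normal_pdf_tail_le (p : nat) (s y x : R) : 0 < s -> 0 < y -> y <= `|x| ->
  normal_pdf 0 s x <= Num.sqrt 2 * (4 * p%:R) ^+ p * (s ^+ 2 / y ^+ 2) ^+ p *
    normal_pdf 0 (Num.sqrt 2 * s) x.
Proof.
move=> s0 y0 yx.
have q0 : 0 < Num.sqrt 2 :> R by rewrite sqrtr_gt0.
have q2 : Num.sqrt 2 ^+ 2 = 2 :> R by rewrite sqr_sqrtr.
have qs0 : 0 < Num.sqrt 2 * s by rewrite mulr_gt0.
rewrite /normal_pdf (gt_eqF s0) (gt_eqF qs0) /normal_peak /normal_fun !subr0 /=.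
have x20 : 0 < x ^+ 2 by rewrite -real_normK ?num_real // exprn_gt0 //
  (lt_le_trans y0).
have yx2 : y ^+ 2 <= x ^+ 2 by rewrite -[x ^+ 2]real_normK ?num_real // lerXn2r
  ?nnegrE // ltW.
have e1 : - x ^+ 2 / (s ^+ 2 *+ 2) = - (x ^+ 2 / (4 * s ^+ 2)) + - (x ^+ 2 / (4 *
  s ^+ 2)).
  by rewrite -mulr_natr; field; rewrite gt_eqF.
have e2 : - x ^+ 2 / ((Num.sqrt 2 * s) ^+ 2 *+ 2) = - (x ^+ 2 / (4 * s ^+ 2)).
  by rewrite exprMn q2 -mulr_natr; field; rewrite gt_eqF.
rewrite e1 e2 expRD.
set E := expR _.
have hE : E <= (4 * p%:R) ^+ p * (s ^+ 2 / y ^+ 2) ^+ p.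
  apply: (@le_trans _ _ (expR (- (y ^+ 2 / (4 * s ^+ 2))))).
    by rewrite ler_expR lerN2 ler_pM2r // invr_gt0 mulr_gt0 // exprn_gt0.
  have := @expRN_le_pow p (y ^+ 2 / (4 * s ^+ 2)).
  rewrite divr_gt0 ?mulr_gt0 ?exprn_gt0 // => /(_ isT) /le_trans; apply.
  rewrite -exprMn le_eqVlt; apply/orP; left; apply/eqP; congr (_ ^+ p).
  by field; rewrite !gt_eqF.
have e3 : Num.sqrt (s ^+ 2 * pi *+ 2) = s * Num.sqrt (pi *+ 2).
  by rewrite -mulrnAr sqrtrM ?sqr_ge0 // sqrtr_sqr gtr0_norm.
have e4 : Num.sqrt ((Num.sqrt 2 * s) ^+ 2 * pi *+ 2) = Num.sqrt 2 * s * Num.sqrt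
  (pi *+ 2).
  by rewrite -mulrnAr sqrtrM ?sqr_ge0 // sqrtr_sqr gtr0_norm.
rewrite e3 e4.
have p0 : 0 < Num.sqrt (pi *+ 2) :> R by rewrite sqrtr_gt0 pmulrn_lgt0 // pi_gt0.
set K := (4 * p%:R) ^+ p * _ in hE *.
have -> : Num.sqrt 2 * (4 * p%:R) ^+ p * (s ^+ 2 / y ^+ 2) ^+ p *
   ((Num.sqrt 2 * s * Num.sqrt (pi *+ 2))^-1 * E) = K * ((s * Num.sqrt (pi *+
     2))^-1 * E).
  by rewrite /K; field; rewrite !gt_eqF.
rewrite mulrA mulrC; apply: ler_wpM2r => //.
by rewrite mulr_ge0 ?expR_ge0 // invr_ge0 mulr_ge0 // ltW.
Qed.

Lemma normal_prob_tail_le (p : nat) (s y : R) : 0 < s -> 0 < y ->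
  (normal_prob 0 s [set x : R | (y < `|x|)%R] <=
   (Num.sqrt 2 * (4 * p%:R) ^+ p * (s ^+ 2 / y ^+ 2) ^+ p)%:E)%E.
Proof.
move=> s0 y0; set K := (_ * _ * _)%R.
have K0 : 0 <= K.
  apply: mulr_ge0; first by rewrite mulr_ge0 ?sqrtr_ge0 // exprn_ge0 // mulr_ge0.
  by rewrite exprn_ge0 // divr_ge0 // exprn_ge0 // ltW.
have mA := measurable_gt_norm y.
apply: (@le_trans _ _ (\int[mu]_(x in [set x : R | (y < `|x|)%R]) (K%:E *
  (normal_pdf 0 (Num.sqrt 2 * s) x)%:E))%E).
  apply: ge0_le_integral => //.
  - by move=> x _; rewrite lee_fin normal_pdf_ge0.
  - by apply/measurable_EFinP; apply: measurable_funTS; exact: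
      measurable_normal_pdf.
  - apply: emeasurable_funM => //; apply/measurable_EFinP; apply:
      measurable_funTS; exact: measurable_normal_pdf.
  - move=> x /= yx; rewrite -EFinM lee_fin; apply: normal_pdf_tail_le => //;
      exact: ltW.
rewrite ge0_integralZl //; last 2 first.
  - by apply/measurable_EFinP; apply: measurable_funTS; exact:
      measurable_normal_pdf.
  - by move=> x _; rewrite lee_fin normal_pdf_ge0.
rewrite -[leRHS]mule1; apply: lee_wpmul2l => //.
exact: (@probability_le1 _ _ _ (normal_prob 0 (Num.sqrt 2 * s)) _ mA).
Qed.

End normal_tail.

Lemma measure_bigcup_le_series d (T : measurableType d) (R : realType)
    (P : {measure set T -> \bar R}) (A : nat -> set T) (b : nat -> R) (B : R) :
  (forall n, measurable (A n)) -> (forall n, (P (A n) <= (b n)%:E)%E) ->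
  (forall N, \sum_(0 <= i < N) b i <= B) -> (P (\bigcup_n A n) <= B%:E)%E.
Proof.
move=> mA hA hb.
have mU : measurable (\bigcup_n A n) by exact: bigcup_measurable.
apply: (le_trans (measure_sigma_subadditive P mA mU (@subset_refl _ _))).
apply: lime_le; first exact: is_cvg_nneseries.
near=> N; apply: (@le_trans _ _ (\sum_(0 <= i < N) (b i)%:E)%E).
  by apply: lee_sum.
by rewrite sumEFin lee_fin.
Unshelve. all: by end_near.
Qed.

Section series_bounds.
Context {R : realType}.

Lemma sum_half_pow_le (C : R) (N : nat) : 0 <= C ->
  \sum_(0 <= i < N) C * 2^-1 ^+ i <= 2 * C.
Proof.
move=> C0; suff -> : \sum_(0 <= i < N) C * 2^-1 ^+ i = 2 * C - 2 * C * 2^-1 ^+ N.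
  by rewrite gerBl mulr_ge0 ?mulr_ge0 // exprn_ge0.
elim: N => [|N IH]; first by rewrite big_geq // expr0; ring.
by rewrite big_nat_recr //= IH exprS; field.
Qed.

Lemma sum_inv_sqr_le (C : R) (N : nat) : 0 <= C ->
  \sum_(0 <= i < N) C / (i.+1)%:R ^+ 2 <= 2 * C.
Proof.
move=> C0; case: N => [|N]; first by rewrite big_geq // mulr_ge0.
suff : \sum_(0 <= i < N.+1) C / (i.+1)%:R ^+ 2 <= 2 * C - C / N.+1%:R.
  by move/le_trans; apply; rewrite gerBl divr_ge0.
elim: N => [|N IH]; first by rewrite big_nat1 expr1n !divr1; lra.
rewrite big_nat_recr //=; apply: (le_trans (lerD IH (lexx _))).
set x : R := N.+1%:R; have x0 : 0 < x by rewrite ltr0n.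
have -> : N.+2%:R = x + 1 :> R by rewrite natr1.
rewrite -addrA lerD2l -subr_ge0.
have -> : - (C / (x + 1)) - (- (C / x) + C / (x + 1) ^+ 2) = C / (x * (x + 1) ^+ 2).
  by field; rewrite !gt_eqF // addr_gt0.
by rewrite divr_ge0 // mulr_ge0 ?exprn_ge0 ?addr_ge0 // ltW.
Qed.

End series_bounds.

(** * Almost sure bounds on dyadic increments *)

Section brownian_increments.
Context d (T : measurableType d) (R : realType) (P : probability T R).
Variables (W : R -> {RV P >-> R}).
Hypothesis bmW : standard_brownian_motion W.
Variable q : nat.
Local Notation p := q.+1.

Let incr (n k : nat) (om : T) : R :=
  W (k.+1%:R * 2^-1 ^+ n) om - W (k%:R * 2^-1 ^+ n) om.

(** The exponents are such that the power [2 p] of the modulus is [2^(- n q) * (k + 1)^2]. As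
    [p = q + 1], the tail bound for a variance [2^-n] becomes a multiple of [2^-n / (k + 1)^2],
    which is summable over [n] and [k]. *)
Definition modulus (n k : nat) : R :=
  ((2^-1 : R) ^+ n) `^ (q%:R / (2 * p%:R)) * (k.+1%:R : R) `^ (p%:R^-1).

Let E (i n k : nat) : set T := [set om | i.+1%:R * modulus n k < `|incr n k om|].

Let X0 n : 0 < (2^-1 : R) ^+ n. Proof. by rewrite exprn_gt0 // invr_gt0. Qed.

Let modulus_gt0 n k : 0 < modulus n k.
Proof. by rewrite mulr_gt0 // powR_gt0. Qed.

Let modulus_pow n k : (modulus n k ^+ 2) ^+ p = ((2^-1 : R) ^+ n) ^+ q * k.+1%:R
  ^+ 2.
Proof.
have pn : p%:R != 0 :> R by rewrite pnatr_eq0.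
have pw (x e : R) : (x `^ e) ^+ (2 * p) = x `^ (e * (2 * p)%:R).
  by rewrite -powR_mulrn ?powR_ge0 // -powRrM.
rewrite -exprM exprMn !pw; congr (_ * _).
  have -> : q%:R / (2 * p%:R) * (2 * p)%:R = q%:R :> R by rewrite natrM; field.
  by rewrite powR_mulrn // ltW.
have -> : p%:R^-1 * (2 * p)%:R = 2%:R :> R by rewrite natrM; field.
by rewrite powR_mulrn.
Qed.

Let mE i n k : measurable (E i n k).
Proof.
have mW : measurable_fun setT (incr n k) by apply: measurable_funB.
have := mW measurableT _ (measurable_gt_norm (i.+1%:R * modulus n k)).
by rewrite setTI.
Qed.

Let C0 : R := Num.sqrt 2 * (4 * p%:R) ^+ p.

Let C0_ge0 : 0 <= C0.
Proof. by rewrite mulr_ge0 ?sqrtr_ge0 // exprn_ge0 // mulr_ge0. Qed.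

Let PE i n k : (P (E i n k) <= (C0 / i.+1%:R * 2^-1 ^+ n / k.+1%:R ^+ 2)%:E)%E.
Proof.
have X1 : (2^-1 : R) ^+ n = k.+1%:R * 2^-1 ^+ n - k%:R * 2^-1 ^+ n.
  by rewrite -[k.+1%:R]natr1; ring.
have st : (k%:R : R) * 2^-1 ^+ n < k.+1%:R * 2^-1 ^+ n.
  by rewrite ltr_pM2r // ltr_nat.
have s0 : 0 <= (k%:R : R) * 2^-1 ^+ n by rewrite mulr_ge0 // ltW.
have := brownian_gauss bmW s0 st (measurable_gt_norm (i.+1%:R * modulus n k)).
rewrite -X1 => ->.
have y0 : 0 < i.+1%:R * modulus n k by rewrite mulr_gt0.
have sX : 0 < Num.sqrt ((2^-1 : R) ^+ n) by rewrite sqrtr_gt0.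
apply: (le_trans (@normal_prob_tail_le R p _ _ sX y0)); rewrite lee_fin -/C0.
rewrite sqr_sqrtr ?(ltW (X0 n)) // expr_div_n [(_ * modulus n k) ^+ 2]exprMn [(_
  * _) ^+ p]exprMn modulus_pow.
have i0 : 0 < i.+1%:R :> R by rewrite ltr0n.
have i1 : i.+1%:R <= (i.+1%:R ^+ 2) ^+ p :> R.
  by rewrite -exprM ler_eXnr // ler1n.
have k0 : 0 < k.+1%:R :> R by rewrite ltr0n.
have -> : ((2^-1 : R) ^+ n) ^+ p / ((i.+1%:R ^+ 2) ^+ p * ((2^-1 ^+ n) ^+ q *
  k.+1%:R ^+ 2)) =
   ((i.+1%:R ^+ 2) ^+ p)^-1 * (2^-1 ^+ n / k.+1%:R ^+ 2).
  rewrite exprS; move: (X0 n) i0 k0; move: (_ ^+ n) (i.+1%:R) (k.+1%:R) => x y z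
    x0 y0' z0.
  by field; rewrite !gt_eqF // ?exprn_gt0.
have e1 (u x y z : R) : u / x * y / z = u * (x^-1 * (y / z)) by rewrite !mulrA.
rewrite e1; apply: (ler_wpM2l C0_ge0); apply: ler_wpM2r.
  by rewrite divr_ge0 // ?exprn_ge0 // ltW.
by rewrite lef_pV2 ?posrE ?exprn_gt0.
Qed.

Let N : set T := \bigcap_i \bigcup_n \bigcup_k E i n k.

Let N_measurable : measurable N.
Proof. by apply: bigcap_measurableType => i _; do 2 apply: bigcup_measurable => ?
  _. Qed.

Let PN : P N = 0%E.
Proof.
(* The sums over [k] and over [n] each contribute a factor 2. Letting [i] grow gives probability
   0. *)
have PNi i : (P N <= (4 * C0 / i.+1%:R)%:E)%E.
  apply: (@le_trans _ _ (P (\bigcup_n \bigcup_k E i n k))).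
    apply: le_measure; rewrite ?inE //.
      by do 2 apply: bigcup_measurable => ? _.
    by move=> om; apply.
  apply: (@measure_bigcup_le_series _ _ _ _ _ (fun n => (2 * C0 / i.+1%:R) * 2^-1
    ^+ n)).
  - by move=> n; apply: bigcup_measurable.
  - move=> n; apply: (@measure_bigcup_le_series _ _ _ _ _ _ _ _ (PE i n)) => // M.
    have -> : 2 * C0 / i.+1%:R * 2^-1 ^+ n = 2 * (C0 / i.+1%:R * 2^-1 ^+ n) by
      rewrite !mulrA.
    by apply: sum_inv_sqr_le; rewrite mulr_ge0 ?divr_ge0 // ltW.
  - move=> M; apply: (le_trans (sum_half_pow_le _ _)).
      by rewrite divr_ge0 // mulr_ge0.
    by rewrite !mulrA -natrM.
apply/eqP; rewrite eq_le measure_ge0 andbT.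
have fin : P N \is a fin_num by exact: fin_num_measure.
rewrite -(fineK fin) lee_fin; apply/ler_addgt0Pr => e e0; rewrite add0r.
pose i := Num.truncn (4 * C0 / e).
have := PNi i; rewrite -(fineK fin) lee_fin => /le_trans; apply.
have /truncn_itv/andP[_ hi] : 0 <= 4 * C0 / e by rewrite divr_ge0 ?mulr_ge0 // ltW.
by rewrite ler_pdivrMr // [leRHS]mulrC -ler_pdivrMr // ltW.
Qed.

Lemma brownian_dyadic_increments : {ae P, forall om, exists2 C : R, 0 <= C &
  forall n k : nat, `|W (k.+1%:R * 2^-1 ^+ n) om - W (k%:R * 2^-1 ^+ n) om|
    <= C * modulus n k}.
Proof.
exists N; split=> // om /= H; apply: contrapT => hN; apply: H.
have [i hi] : exists i, ~ (\bigcup_n \bigcup_k E i n k) om.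
  by apply: contrapT => h; apply: hN => i _; apply: contrapT => h2; apply: h;
    exists i.
exists i.+1%:R => // n k; rewrite leNgt; apply/negP => h; apply: hi.
by exists n => //; exists k.
Qed.

(** On [[0, J]] the index satisfies [k + 1 <= 2^n * J], so the factor in [k] costs [1 / p] in the
    exponent of [2^-n] and yields the growth exponent [1 / p] in [J]. *)
Lemma modulus_le (n k J : nat) : (k < 2 ^ n * J)%N ->
  modulus n k <= (J%:R : R) `^ (p%:R^-1) *
    (2^-1 `^ (q%:R / (2 * p%:R) - p%:R^-1)) ^+ n.
Proof.
move=> kJ; have h0 : 0 <= (2^-1 : R) by rewrite invr_ge0.
have h1 : (k.+1%:R : R) `^ p%:R^-1 <= ((2^-1 ^+ n)^-1 * J%:R) `^ p%:R^-1.
  apply: ge0_ler_powR; rewrite ?nnegrE ?invr_ge0 ?mulr_ge0 ?invr_ge0 ?exprn_ge0 //.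
  by rewrite exprVn invrK -natrX -natrM ler_nat.
apply: (le_trans (ler_wpM2l (powR_ge0 _ _) h1)).
rewrite powRM ?invr_ge0 ?exprn_ge0 // mulrA [leRHS]mulrC -powR_exprn //.
rewrite powRD; last by rewrite (gt_eqF (X0 n)) implybT.
have inv (x e : R) : 0 <= x -> x^-1 `^ e = x `^ (- e).
  by move=> x0; rewrite -(powR_inv1 x0) -powRrM mulN1r.
by rewrite inv // exprn_ge0.
Qed.

End brownian_increments.

(** * Chaining over dyadic points *)

Section chaining.
Context {R : realType}.
Variables (w : R -> R) (lam : R) (J : nat) (K : R).
Hypotheses (lam_gt0 : 0 < lam) (cw : continuous (clamp w)) (K_ge0 : 0 <= K).
Local Notation r := ((2^-1 : R) `^ lam).
Hypothesis dyadic_increments : forall n k : nat, (k < 2 ^ n * J)%N ->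
  `|w (k.+1%:R * 2^-1 ^+ n) - w (k%:R * 2^-1 ^+ n)| <= K * r ^+ n.

Let h0 : 0 < (2^-1 : R). Proof. by rewrite invr_gt0. Qed.
Let q0 n : 0 < (2^-1 : R) ^+ n. Proof. exact: exprn_gt0. Qed.
Let r0 : 0 < r. Proof. exact: powR_gt0. Qed.
Let r1 : r < 1. Proof. exact: powR_half_lt1. Qed.

Definition dyadic_floor (n : nat) (t : R) : nat := Num.truncn (t * 2 ^+ n).

Let dfP n t : 0 <= t ->
  (dyadic_floor n t)%:R * 2^-1 ^+ n <= t < ((dyadic_floor n t).+1)%:R * 2^-1 ^+ n.
Proof. by move=> t0; rewrite -[(dyadic_floor n t).+1%:R]natr1 mulrDl mul1r;
  exact: dyadic_approx. Qed.

Let df_lt (n k : nat) t : 0 <= t -> t < k%:R * 2^-1 ^+ n -> (dyadic_floor n t <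
  k)%N.
Proof.
move=> t0 tk; have /andP[h _] := dfP n t0.
by have := le_lt_trans h tk; rewrite ltr_pM2r // ltr_nat.
Qed.

Let df_ge (n k : nat) t : 0 <= t -> k%:R * 2^-1 ^+ n <= t -> (k <= dyadic_floor n
  t)%N.
Proof.
move=> t0 kt; have /andP[_ h] := dfP n t0.
by have := le_lt_trans kt h; rewrite ltr_pM2r // ltr_nat ltnS.
Qed.

Let half (m n : nat) : m%:R * (2^-1 : R) ^+ n = (2 * m)%N%:R * 2^-1 ^+ n.+1.
Proof. by rewrite natrM exprS; field. Qed.

Let df_leJ n t : 0 <= t -> t <= J%:R -> (dyadic_floor n t <= 2 ^ n * J)%N.
Proof.
move=> t0 tJ; have /andP[h _] := dfP n t0.
have := le_trans h tJ; rewrite -ler_pdivlMr // -exprVn invrK -natrX -natrM ler_nat.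
by rewrite mulnC.
Qed.

(** The dyadic floor of the next level is the same point or one fine step to its right, so at most
    one dyadic increment is involved. *)
Let approx_step n t : 0 <= t -> t <= J%:R ->
  `|w ((dyadic_floor n.+1 t)%:R * 2^-1 ^+ n.+1) - w ((dyadic_floor n t)%:R * 2^-1
    ^+ n)|
   <= K * r ^+ n.
Proof.
move=> t0 tJ; set m := dyadic_floor n t.
have /andP[m1 m2] := dfP n t0; rewrite -/m in m1 m2.
have l1 : (2 * m <= dyadic_floor n.+1 t)%N by apply: df_ge => //; rewrite -(half
  m n).
have l2 : (dyadic_floor n.+1 t < 2 * m.+1)%N by apply: df_lt => //; rewrite
  -(half m.+1 n).
have Kr : K * r ^+ n.+1 <= K * r ^+ n.
  by rewrite ler_wpM2l // exprS ler_piMl ?exprn_ge0 ?(ltW r0) ?(ltW r1).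
rewrite (half m n); have [e|e] : dyadic_floor n.+1 t = (2 * m)%N \/ dyadic_floor
  n.+1 t = (2 * m).+1.
- by move: l1 l2; rewrite mulnS add2n ltnS leq_eqVlt => /predU1P[->|h1 h2];
    [left|right; apply/eqP; rewrite eqn_leq h1 h2].
- by rewrite e subrr normr0 mulr_ge0 // exprn_ge0 // ltW.
- rewrite e; apply: le_trans Kr; apply: dyadic_increments.
  by rewrite -e; exact: df_leJ.
Qed.

Let approx n t : 0 <= t -> t <= J%:R ->
  `|w ((dyadic_floor n t)%:R * 2^-1 ^+ n) - w t| <= K * r ^+ n / (1 - r).
Proof.
move=> t0 tJ.
have [l hl] := geometric_increments_limit r0 r1 (fun n => approx_step n t0 tJ).
suff -> : w t = l by exact: hl.
have r1' : 0 < 1 - r by rewrite subr_gt0.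
apply/eqP; rewrite -subr_eq0 -normr_le0; apply/ler_addgt0Pr => e e0; rewrite add0r.
have e20 : 0 < e / 2 by rewrite divr_gt0.
have /cvgrPdist_lt/(_ _ e20)[d /= d0 hd] : clamp w x @[x --> t] --> clamp w t :=
  @cw t.
have [n1 hn1] := half_pow_lt d0.
have [n2 hn2] := pow_small (K / (1 - r)) r0 r1 e20.
pose m := maxn n1 n2.
have h1 := hn1 m (leq_maxl _ _); have h2 := hn2 m (leq_maxr _ _).
have /andP[a1 a2] := dfP m t0.
have s0 : 0 <= (dyadic_floor m t)%:R * (2^-1 : R) ^+ m by rewrite mulr_ge0 // ltW.
set s := _ * _ in a1 s0.
have h3 := hl m; rewrite -/s in h3.
have h4 : `|w t - w s| < e / 2.
  rewrite -(clampE _ t0) -(clampE _ s0); apply: hd; rewrite /= ger0_norm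
    ?subr_ge0 //.
  apply: le_lt_trans h1; rewrite lerBlDl ltW //.
  by move: a2; rewrite -[(dyadic_floor m t).+1%:R]natr1 mulrDl mul1r.
have -> : e = e / 2 + e / 2 by field.
apply: (le_trans (ler_distD (w s) _ _)); apply: lerD; first exact: ltW.
by apply: (le_trans h3); rewrite mulrAC ltW.
Qed.

(** The two end points contribute [1 / (1 - r)] each, and the step between their dyadic floors
    contributes 1. *)
Definition holder_const : R := 2 / (1 - r) + 1.

Lemma chaining_holder s t : 0 <= s -> s <= t -> t <= J%:R -> t - s <= 1 ->
  `|w t - w s| <= K * holder_const / r * (t - s) `^ lam.
Proof.
move=> s0 st tJ ts1.
have t0 : 0 <= t := le_trans s0 st.
have sJ : s <= J%:R := le_trans st tJ.
have r1' : 0 < 1 - r by rewrite subr_gt0.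
have c0 : 0 <= holder_const by rewrite /holder_const addr_ge0 // divr_ge0 // ltW.
move: st; rewrite le_eqVlt => /predU1P[->|st].
  by rewrite subrr normr0 !mulr_ge0 ?invr_ge0 ?powR_ge0.
have d0 : 0 < t - s by rewrite subr_gt0.
(* The upper bound makes the floors of [s] and [t] equal or adjacent. The lower bound turns [r^n]
   into [(t - s)^lam] at the cost of one factor [1 / r]. *)
have [n nd dn] : exists2 n : nat, t - s <= 2^-1 ^+ n & 2^-1 ^+ n.+1 < t - s.
  have [n0 hn0] := half_pow_lt d0.
  have ex : exists n, (2^-1 : R) ^+ n < t - s by exists n0; exact: hn0.
  have := ex_minnP ex; case=> -[|n].
    by rewrite expr0 => h; have := lt_le_trans h ts1; rewrite ltxx.
  move=> h hmin; exists n => //; rewrite leNgt; apply/negP => /hmin.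
  by rewrite ltnn.
set a := dyadic_floor n s; set b := dyadic_floor n t.
have /andP[a1 a2] := dfP n s0; rewrite -/a in a1 a2.
have /andP[b1 b2] := dfP n t0; rewrite -/b in b1 b2.
have ab : (a <= b)%N by apply: df_ge => //; exact: le_trans (ltW st).
have ba : (b < a.+2)%N.
  apply: df_lt => //; rewrite -[a.+2%:R]natr1 mulrDl mul1r.
  by apply: (le_lt_trans (_ : t <= 2^-1 ^+ n + s)); [rewrite -lerBlDr|rewrite
    addrC ltrD2r].
have mid : `|w (b%:R * 2^-1 ^+ n) - w (a%:R * 2^-1 ^+ n)| <= K * r ^+ n.
  have bJ : (b <= 2 ^ n * J)%N := df_leJ n t0 tJ.
  move: ab; rewrite leq_eqVlt => /predU1P[<-|h1].
    by rewrite subrr normr0 mulr_ge0 // exprn_ge0 // ltW.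
  have e1 : b = a.+1 by apply/eqP; rewrite eqn_leq -ltnS ba h1.
  by rewrite e1; apply: dyadic_increments; rewrite -e1.
have h1 := approx n t0 tJ; have h2 := approx n s0 sJ.
rewrite -/a -/b in h1 h2; rewrite distrC in h1.
apply: (@le_trans _ _ (K * holder_const * r ^+ n)).
  apply: (le_trans (ler_distD (w (b%:R * 2^-1 ^+ n)) _ _)).
  have -> : K * holder_const * r ^+ n = K * r ^+ n / (1 - r) + (K * r ^+ n + K *
    r ^+ n / (1 - r)).
    by rewrite /holder_const; field; rewrite gt_eqF.
  apply: lerD => //; apply: (le_trans (ler_distD (w (a%:R * 2^-1 ^+ n)) _ _)).
  exact: lerD.
rewrite -[leRHS]mulrA; apply: ler_wpM2l; first exact: mulr_ge0.
rewrite ler_pdivlMl //; rewrite -exprS.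
have -> : r ^+ n.+1 = ((2^-1 : R) ^+ n.+1) `^ lam.
  by rewrite powR_exprn // ltW.
by apply: ge0_ler_powR; rewrite ?nnegrE ?(ltW lam_gt0) ?(ltW (q0 _)) ?(ltW d0)
  ?(ltW dn).
Qed.

End chaining.

(** * The fractional derivative along a path *)

Section fractional_derivative_paths.
Context {R : realType}.
Variables (al lam eta C : R) (w : R -> R).
Hypotheses (al_gt0 : 0 < al) (al_lt1 : al < 1) (al_lam : al < lam) (eta_al : eta
  < al).
Hypotheses (eta_gt0 : 0 < eta) (C_ge0 : 0 <= C).
Hypotheses (w0 : w 0 = 0) (cw : continuous (clamp w)).
Hypothesis w_incr : forall J n k : nat, (k < 2 ^ n * J)%N ->
  `|w (k.+1%:R * 2^-1 ^+ n) - w (k%:R * 2^-1 ^+ n)| <=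
    C * J%:R `^ eta * (2^-1 `^ lam) ^+ n.

Let lam_gt0 : 0 < lam. Proof. exact: lt_trans al_lam. Qed.

Let A : R := holder_const lam / (2^-1 `^ lam).

Let A_ge0 : 0 <= A.
Proof.
rewrite /A divr_ge0 ?powR_ge0 // /holder_const addr_ge0 // divr_ge0 // subr_ge0.
by rewrite ltW // powR_half_lt1.
Qed.

Let CJ (J : nat) : 0 <= C * J%:R `^ eta. Proof. by rewrite mulr_ge0 // powR_ge0.
  Qed.

Let holder (J : nat) s t : 0 <= s -> s <= t -> t <= J%:R -> t - s <= 1 ->
  `|w t - w s| <= C * J%:R `^ eta * A * (t - s) `^ lam.
Proof.
move=> s0 st tJ ts.
have := @chaining_holder R w lam J _ lam_gt0 cw (CJ J) (w_incr (J := J)) s t s0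
  st tJ ts.
by rewrite /A !mulrA.
Qed.

Let clamp_holder (N : R) : exists2 C, 0 <= C & forall s k, s <= N -> 0 <= k <= 1 ->
  `|clamp w (s + k) - clamp w s| <= C * k `^ lam.
Proof.
pose J := (Num.truncn (Num.max N 0 + 1)).+1.
have m0 : 0 <= Num.max N 0 by rewrite le_max lexx orbT.
have NJ : N + 1 <= J%:R.
  have /truncn_itv/andP[_ h] : 0 <= Num.max N 0 + 1 by rewrite addr_ge0.
  by apply: le_trans (ltW h); rewrite lerD2r le_max lexx.
have K0 : 0 <= C * J%:R `^ eta * A by rewrite mulr_ge0.
exists (C * J%:R `^ eta * A) => // s k sN /andP[k0 k1].
have skJ : s + k <= J%:R by apply: le_trans NJ; exact: lerD.
have [s0|s0] := leP 0 s.
  rewrite !clampE ?addr_ge0 //.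
  have e1 : s + k - s = k by ring.
  by have := @holder J s (s + k) s0; rewrite e1; apply; rewrite ?lerDl.
have cs : clamp w s = 0 by rewrite /clamp max_r ?w0 // ltW.
have [sk|sk] := leP 0 (s + k); last first.
  by rewrite cs {1}/clamp max_r ?(ltW sk) // w0 subrr normr0 mulr_ge0 // powR_ge0.
rewrite cs clampE //.
have := @holder J 0 (s + k) (lexx 0) sk skJ; rewrite w0 !subr0 => h.
have skk : s + k <= k by rewrite gerDr ltW.
apply: (le_trans (h (le_trans skk k1))); apply: ler_wpM2l => //.
by apply: ge0_ler_powR; rewrite ?nnegrE ?(ltW lam_gt0).
Qed.

(** Adding unit steps bounds [w] on [[0, J]] by a multiple of [J^(1 + eta)]. The kernel contributes
    [J^(1 - al)], so that [F] grows less than quadratically because [eta < al]. *)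
Let growth (J m : nat) : (m <= J)%N -> forall s, 0 <= s <= m%:R ->
  `|w s| <= m%:R * (C * J%:R `^ eta * A).
Proof.
have K0 : 0 <= C * J%:R `^ eta * A by rewrite mulr_ge0.
elim: m => [_ s h|m IH mJ s /andP[s0 sm]].
  by have -> : s = 0; [apply/le_anti; rewrite andbC|rewrite w0 normr0 mul0r].
have [sm'|ms] := leP s m%:R.
  apply: (le_trans (IH (ltnW mJ) s _)); first by rewrite s0.
  by apply: ler_wpM2r => //; rewrite ler_nat.
have m0 : 0 <= m%:R :> R by [].
have s1 : s - m%:R <= 1 by rewrite lerBlDl natr1.
have sJ : s <= J%:R by apply: (le_trans sm); rewrite ler_nat.
have h1 := holder m0 (ltW ms) sJ s1.
have h2 := IH (ltnW mJ) m%:R; rewrite m0 lexx in h2; have {}h2 := h2 isT.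
have -> : w s = (w s - w m%:R) + w m%:R by ring.
apply: (le_trans (ler_normD _ _)); rewrite -natr1 mulrDl mul1r addrC.
apply: lerD => //; apply: (le_trans h1); rewrite ler_piMr //.
apply: (@le_trans _ _ (1 `^ lam)); last by rewrite powR1.
apply: ge0_ler_powR; rewrite ?nnegrE ?(ltW lam_gt0) //.
by rewrite subr_ge0 ltW.
Qed.

Lemma riemann_liouville_path (a : R) :
  [/\ continuous (riemann_liouville al w), riemann_liouville al w 0 = 0 &
   forall K : R, exists2 y, 0 < y & K < y - a * riemann_liouville al w y].
Proof.
have [g [cg g0 dg]] := frac_int_C1 al_gt0 al_lt1 w0 cw al_lam clamp_holder.
pose G := (Gamma (1 - al))^-1.
have -> : riemann_liouville al w = fun y => G * g y.
  apply/funext => y; rewrite /riemann_liouville -/G; congr (_ * _).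
  by rewrite derive1E; have h := dg y; exact: (@derive_val _ _ _ _ _ _ _ h).
split.
- by move=> y; apply: cvgMr; exact: cg.
- by rewrite g0 mulr0.
have a1 : 0 < 1 - al by rewrite subr_gt0.
apply: (frac_int_drift_unbounded a G (B := C * A / (1 - al)) (dl := al - eta) dg).
  by rewrite subr_gt0.
move=> J.
have KJ : 0 <= J%:R * (C * J%:R `^ eta * A) by rewrite mulr_ge0 // mulr_ge0.
apply: (le_trans (frac_int_bound al_gt0 al_lt1 w0 cw KJ (growth (leqnn J)))).
have -> : J%:R * (C * J%:R `^ eta * A) * (J%:R `^ (1 - al) / (1 - al)) =
  C * A / (1 - al) * J%:R * (J%:R `^ eta * J%:R `^ (1 - al)).
  by move: (_ `^ eta) (_ `^ (1 - al)) => x y; ring.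
apply: ler_wpM2l.
  by rewrite mulr_ge0 // divr_ge0 ?(ltW a1) // mulr_ge0.
have J1 : 0 < J.+1%:R :> R by rewrite ltr0n.
have -> : 1 - (al - eta) = eta + (1 - al) by ring.
rewrite powRD; last by rewrite (gt_eqF J1) implybT.
by apply: ler_pM; rewrite ?powR_ge0 //; apply: ge0_ler_powR; rewrite ?nnegrE
  ?ler_nat ?(ltW eta_gt0) ?(ltW a1).
Qed.

End fractional_derivative_paths.

Theorem mainTheorem15 (R : realType) (d : measure_display)
    (T : measurableType d) (P : probability T R)
    (W1 : R -> {RV P >-> R}) (hW1 : standard_brownian_motion W1)
    (a b c alpha : R) (ha : 0 < a) (hb : 0 < b) (hc : 0 < c)
    (halpha0 : 0 < alpha) (halpha1 : alpha < 2^-1)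
    (Walpha : T -> R -> R)
    (hWalpha : forall w, Walpha w = riemann_liouville alpha (fun t => W1 t w))
    (X : nat -> R -> {RV P >-> R})
    (hX : forall n, (0 < n)%N ->
       {ae P, forall w, solves_rode n a b c (Walpha w) (fun t => X n t w)})
    (X0 : R -> T -> R)
    (hX0 : forall t w, X0 t w = fractional_inverse_gaussian a b (Walpha w) t) :
  {ae P, forall w,
    [/\ Phibar (fun t => X0 t w),
        (forall n, (0 < n)%N ->
          [/\ Phibar (fun t => X n t w),
              set_bij (@Rplus R) (@Rplus R) (fun t => X n t w) &
              dist_Phibar (fun t => X n t w) (fun t => X0 t w) =
              norm_Rplus (fun x => exit_time (fun t => X0 t w) x -
                                   inverse_Rplus (fun t => X n t w) x)]) &
        dist_Phibar (fun t => X n t w) (fun t => X0 t w) @[n --> \oo] --> 0%E]}.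
Proof.
(* With [p = q + 1] the Hoelder exponent is [1/2 - 3 / (2 p)] and the growth exponent is [1 / p].
   Both gaps open for large [p] because [0 < alpha < 1/2]; [p > 2 / e] suffices. *)
have [q [q1 q2]] : exists q : nat, alpha < q%:R / (2 * q.+1%:R) - q.+1%:R^-1 /\
    q.+1%:R^-1 < alpha.
  have [e [e0 e1 e2]] : exists e, [/\ 0 < e, e <= alpha & e <= 2^-1 - alpha].
    exists (Num.min alpha (2^-1 - alpha)).
    by rewrite lt_min halpha0 subr_gt0 !ge_min !lexx orbT.
  exists (Num.truncn (2 / e)).
  have /truncn_itv/andP[_] : 0 <= 2 / e by rewrite divr_ge0 // ltW.
  move: (Num.truncn _) => q hq.
  have p0 : 0 < q.+1%:R :> R by rewrite ltr0n.
  have -> : q%:R / (2 * q.+1%:R) = 2^-1 - 2^-1 / q.+1%:R :> R.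
    by rewrite -[q.+1%:R]natr1; field; rewrite natr1 gt_eqF.
  have h : q.+1%:R^-1 < e / 2.
    by rewrite -[e / 2]invrK ltf_pV2 ?posrE ?invr_gt0 ?divr_gt0 // invf_div.
  by move: h; move: (q.+1%:R^-1) => y h; split; lra.
(* The exceptional sets of the countably many equations are united, so that all solutions are
   available along one path. *)
have aeX : {ae P, forall w, forall n, (0 < n)%N ->
    solves_rode n a b c (Walpha w) (fun t => X n t w)}.
  apply: ae_foralln => n; case: n => [|n].
    by apply: aeW => w.
  have := hX n.+1 (ltn0Sn n); move=> [N [mN PN sN]].
  exists N; split=> // w h; apply: sN => /= h2; exact: h.
have aeI := brownian_dyadic_increments hW1 q.
have ae0 := brownian_start hW1.
have aeC := brownian_continuous hW1.
apply: filterS (filterI (filterI aeX aeI) (filterI ae0 aeC)) => w /= [[hx [C C0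
  hC]] [w0 /within_Rplus_continuous_clamp cw]].
have al1 : alpha < 1 by lra.
have eta0 : 0 < q.+1%:R^-1 :> R by rewrite invr_gt0 ltr0n.
have incr J n k : (k < 2 ^ n * J)%N ->
    `|W1 (k.+1%:R * 2^-1 ^+ n) w - W1 (k%:R * 2^-1 ^+ n) w| <=
    C * J%:R `^ (q.+1%:R^-1) * (2^-1 `^ (q%:R / (2 * q.+1%:R) - q.+1%:R^-1)) ^+ n.
  move=> kJ; apply: (le_trans (hC n k)); rewrite -mulrA.
  by apply: ler_wpM2l => //; exact: modulus_le.
have [cv v0 dv] := riemann_liouville_path halpha0 al1 q1 q2 eta0 C0 w0 cw incr a.
rewrite -(hWalpha w) in cv v0 dv.
exact: (path_conclusion hb hc cv v0 dv hx (fun t => hX0 t w)).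
Qed.
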